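(* Let $n,k,r$ be nonnegative integers with $r\le n$. Endow monomials in $\mathbb{Q}[x_1,\dots,x_n]$ with the lexicographic term order. A Gröbner basis for the ideal $I_{n,k,r}$ consists of the polynomials $$h_{k+1}(x_1,x_2,\dots,x_n),\ h_{k+2}(x_2,\dots,x_n),\ \dots,\ h_{k+n}(x_n)$$ together with the polynomials $\kappa_{\gamma(S)^*}(\mathbf{x}_n^* )$, where $S$ ranges over all $(n-r+1)$-element subsets of $[n]=\{1,\dots,n\}$. When $r<n$ and $k>0$ this Gröbner basis is minimal.
   Context: For any list of variables, $e_d$ and $h_d$ denote the elementary and complete homogeneous symmetric polynomials of degree $d$ in those variables; $\mathbf{x}_n=(x_1,\dots,x_n)$. For nonnegative integers $n,k,r$ with $r\le n$, $I_{n,k,r}\subseteq\mathbb{Q}[\mathbf{x}_n]$ is the ideal $\langle h_{k+1}(\mathbf{x}_n),\dots,h_{k+n}(\mathbf{x}_n),\,e_n(\mathbf{x}_n),e_{n-1}(\mathbf{x}_n),\dots,e_{n-r+1}(\mathbf{x}_n)\rangle$. Lexicographic order: $x_1^{a_1}\cdots x_n^{a_n}<x_1^{b_1}\cdots x_n^{b_n}$ if for some $i$ we have $a_1=b_1,\dots,a_{i-1}=b_{i-1}$ and $a_i<b_i$. A finite set $G$ of nonzero elements of an ideal $I$ is a Gröbner basis if the leading (greatest) terms of elements of $G$ generate the ideal generated by the leading terms of all nonzero elements of $I$. It is minimal if every leading coefficient is $1$ and no leading term of an element of $G$ divides the leading term of another element of $G$. For $S=\{s_1<\cdots<s_m\}\subseteq[n]$,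 the skip vector $\gamma(S)=(\gamma(S)_1,\dots,\gamma(S)_n)$ is given by $\gamma(S)_i=s_j-j+1$ if $i=s_j$, and $\gamma(S)_i=0$ if $i\notin S$. $\gamma(S)^*=(\gamma(S)_n,\dots,\gamma(S)_1)$ is its reversal. Demazure characters $\kappa_\gamma(\mathbf{x}_n)$, for $\gamma=(\gamma_1,\dots,\gamma_n)$ a vector of nonnegative integers, are defined recursively: if $\gamma_1\ge\cdots\ge\gamma_n$ then $\kappa_\gamma=x_1^{\gamma_1}\cdots x_n^{\gamma_n}$; if $\gamma_i<\gamma_{i+1}$ then $\kappa_\gamma=\pi_i(\kappa_{\gamma'})$, where $\gamma'$ is $\gamma$ with entries $i$ and $i+1$ interchanged and $\pi_i(f)=\dfrac{x_if-x_{i+1}s_i(f)}{x_i-x_{i+1}}$, with $s_i$ interchanging $x_i$ and $x_{i+1}$ (this is well defined). For a polynomial $f(\mathbf{x}_n)$, $f(\mathbf{x}_n^* )=f(x_n,x_{n-1},\dots,x_1)$. *)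

(* Defs.v *)
(* The variable x_i (1 <= i <= n) is 'X_j, with j : 'I_n of value i - 1. *)
From HB Require Import structures.
From mathcomp Require Import all_boot all_order all_fingroup all_algebra.
From mathcomp Require Import zify ring.
From mathcomp.multinomials Require Export mpoly.

Set Implicit Arguments.
Unset Strict Implicit.
Unset Printing Implicit Defensive.

Import GRing.Theory.
Local Open Scope ring_scope.

Definition ideal_span (R : comNzRingType) (A : R -> Prop) (p : R) : Prop :=
  exists2 s : seq (R * R),
    forall c, c \in s -> A c.2 & p = \sum_(c <- s) c.1 * c.2.

Section Lex.
Variable n : nat.
Implicit Types (m : 'X_{1..n}) (p g : {mpoly rat[n]}).

(* The order that the library puts on 'X_{1..n} compares total degrees first,
   so the lexicographic order is defined here. *)
Definition lexlt m1 m2 : bool :=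
  [exists i : 'I_n, (m1 i < m2 i)%N &&
     [forall j : 'I_n, (j < i)%N ==> (m1 j == m2 j)]].

Definition lexlead p : 'X_{1..n} :=
  foldr (fun m m0 => if lexlt m0 m then m else m0) 0%MM (msupp p).

Definition lexleadc p : rat := p@_(lexlead p).

Definition lexterm p : {mpoly rat[n]} := lexleadc p *: 'X_[lexlead p].

Lemma lexlt_trans m2 m1 m3 : lexlt m1 m2 -> lexlt m2 m3 -> lexlt m1 m3.
Proof.
case/existsP=> i /andP[lt12 /forallP eq12].
case/existsP=> j /andP[lt23 /forallP eq23].
have e12 (k : 'I_n) : (k < i)%N -> m1 k = m2 k by move/(implyP (eq12 k))/eqP.
have e23 (k : 'I_n) : (k < j)%N -> m2 k = m3 k by move/(implyP (eq23 k))/eqP.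
case: (ltngtP i j) => [ij|ji|/val_inj eij].
- apply/existsP; exists i; rewrite -e23 // lt12.
  by apply/forallP=> k; apply/implyP=> ki; rewrite e12 // e23 // (ltn_trans ki).
- apply/existsP; exists j; rewrite e12 // lt23.
  by apply/forallP=> k; apply/implyP=> kj; rewrite e12 ?e23 // (ltn_trans kj).
- subst j; apply/existsP; exists i; rewrite (ltn_trans lt12 lt23).
  by apply/forallP=> k; apply/implyP=> ki; rewrite e12 ?e23.
Qed.

Lemma lexlt_total m1 m2 : m1 != m2 -> lexlt m1 m2 || lexlt m2 m1.
Proof.
move=> ne; have /existsP[i0 ne0] : [exists i, m1 i != m2 i].
  rewrite -negb_forall; apply: contra ne => /forallP e.
  by apply/eqP/mnmP=> i; apply/eqP.
case: (@arg_minnP _ i0 (fun i => m1 i != m2 i) (fun i => i : nat) ne0)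
  => i ne_i mini.
have e (j : 'I_n) : (j < i)%N -> m1 j == m2 j.
  by move=> ji; apply: contraLR ji => /mini; rewrite -leqNgt.
case: (ltngtP (m1 i) (m2 i)) ne_i => // lt _; apply/orP; [left|right].
- by apply/existsP; exists i; rewrite lt; apply/forallP=> j; apply/implyP/e.
- apply/existsP; exists i; rewrite lt; apply/forallP=> j.
  by apply/implyP=> /e; rewrite eq_sym.
Qed.

Lemma lexleadP p : p != 0 ->
  lexlead p \in msupp p /\
  (forall m, m \in msupp p -> m != lexlead p -> lexlt m (lexlead p)).
Proof.
have lex0 m : m != 0%MM -> lexlt 0%MM m.
  move=> m0; case/orP: (lexlt_total m0) => // /existsP[i].
  by rewrite mnm0E ltn0.
rewrite -msupp_eq0 /lexlead; elim: (msupp p) => //= m s IH _.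
case: (eqVneq s [::]) => [-> /=|/IH [ins max]].
  have -> : (if lexlt 0%MM m then m else 0%MM) = m.
    by case: (eqVneq m 0%MM) => [->|/lex0 -> //]; case: ifP.
  by rewrite inE eqxx; split=> // m'; rewrite inE => ->.
set m0 := foldr _ _ s in ins max *; case: ifPn => lt.
  rewrite inE eqxx; split=> // m'; rewrite inE => /orP[-> //|m's _].
  by case: (eqVneq m' m0) => [-> //|/(max _ m's) /lexlt_trans]; apply.
rewrite inE ins orbT; split=> // m'; rewrite inE => /orP[/eqP->|/max //].
by move=> /lexlt_total; rewrite (negbTE lt) orbF.
Qed.

Definition groebner_basis (I : {mpoly rat[n]} -> Prop)
    (G : seq {mpoly rat[n]}) : Prop :=
  (forall g, g \in G -> I g /\ g != 0) /\
  (forall p,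
     ideal_span (fun t => exists2 g, g \in G & t = lexterm g) p <->
     ideal_span (fun t => exists f, [/\ I f, f != 0 & t = lexterm f]) p).

Definition minimal_groebner_basis (I : {mpoly rat[n]} -> Prop)
    (G : seq {mpoly rat[n]}) : Prop :=
  [/\ groebner_basis I G,
      forall g, g \in G -> lexleadc g = 1
    & forall g g', g \in G -> g' \in G -> g != g' ->
        ~ exists q, lexterm g' = q * lexterm g].

End Lex.

(* h_d in the variables 'X_i with i in A: the sum of all monomials of degree d
   in these variables. *)
Definition hsym (n d : nat) (A : {set 'I_n}) : {mpoly rat[n]} :=
  \sum_(m : 'X_{1..n < d.+1} |
        (mdeg m == d) && [forall i, (m i != 0%N) ==> (i \in A)]) 'X_[m].

Definition ideal_I (n k r : nat) : {mpoly rat[n]} -> Prop :=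
  ideal_span (fun p =>
    (exists2 i, (1 <= i <= n)%N & p = hsym (k + i) [set: 'I_n]) \/
    (exists2 j, (n - r + 1 <= j <= n)%N & p = mesym n rat j)).
Arguments ideal_I : clear implicits.

(* If i : 'I_n is the j-th smallest element of S, then
   j = #|[set s in S | s <= i]|; its value in [n] is i.+1. *)
Definition skip_vector (n : nat) (S : {set 'I_n}) : 'X_{1..n} :=
  [multinom (if i \in S then i.+1 - #|[set s in S | (s <= i)%N]| + 1
             else 0)%N | i < n].

Definition mnm_rev (n : nat) (m : 'X_{1..n}) : 'X_{1..n} :=
  [multinom m (rev_ord i) | i < n].

Definition mpoly_rev (n : nat) (p : {mpoly rat[n]}) : {mpoly rat[n]} :=
  p \mPo [tuple 'X_(rev_ord i) | i < n].

Lemma braid_calc (A : comNzRingType) (a b c p sp tp stp tsp stsp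
    g1 tg1 stg1 g2 sg2 g3 h1 sh1 tsh1 h2 th2 h3 : A) :
  (a - b) * g1 = a * p - b * sp ->
  (a - c) * tg1 = a * tp - c * tsp ->
  (b - c) * stg1 = b * stp - c * stsp ->
  (b - c) * g2 = b * g1 - c * tg1 ->
  (a - c) * sg2 = a * g1 - c * stg1 ->
  (a - b) * g3 = a * g2 - b * sg2 ->
  (b - c) * h1 = b * p - c * tp ->
  (a - c) * sh1 = a * sp - c * stp ->
  (a - b) * tsh1 = a * tsp - b * stsp ->
  (a - b) * h2 = a * h1 - b * sh1 ->
  (a - c) * th2 = a * h1 - c * tsh1 ->
  (b - c) * h3 = b * h2 - c * th2 ->
  (a - b) * (a - c) * (b - c) * g3 = (a - b) * (a - c) * (b - c) * h3.
Proof.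
move=> G1 tG1 stG1 G2 sG2 G3 H1 sH1 tsH1 H2 tH2 H3.
transitivity (a * b * (a * p - b * sp) - a * c * (a * tp - c * tsp)
              + b * c * (b * stp - c * stsp)).
  transitivity ((a - c) * (b - c) * ((a - b) * g3)); first by ring.
  rewrite G3.
  transitivity (a * (a - c) * ((b - c) * g2) - b * (b - c) * ((a - c) * sg2)).
    by ring.
  rewrite G2 sG2.
  transitivity (a * b * ((a - b) * g1) - a * c * ((a - c) * tg1)
                + b * c * ((b - c) * stg1)); first by ring.
  by rewrite G1 tG1 stG1.
transitivity ((a - b) * (a - c) * ((b - c) * h3)); last by ring.
rewrite H3.
transitivity (b * (a - c) * ((a - b) * h2) - c * (a - b) * ((a - c) * th2));
  last by ring.
rewrite H2 tH2.
transitivity (a * a * ((b - c) * h1) - b * b * ((a - c) * sh1)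
              + c * c * ((a - b) * tsh1)); last by ring.
by rewrite H1 sH1 tsH1; ring.
Qed.

Section DemazureOperator.
Variable n : nat.
Implicit Types (i j k : 'I_n) (p q f : {mpoly rat[n]}) (s : 'S_n).

Lemma msym_var s i : msym s 'X_i = 'X_(s i) :> {mpoly rat[n]}.
Proof. by rewrite /msym mmapX mmap1U. Qed.

Lemma demazure_pi_exists i j p : exists q,
  ('X_i - 'X_j) * q == 'X_i * p - 'X_j * msym (tperm i j) p.
Proof.
pose D f := exists q, f - msym (tperm i j) f = ('X_i - 'X_j) * q.
suff [q Dq] : D p.
  exists (p + 'X_j * q); apply/eqP.
  have -> : msym (tperm i j) p = p - ('X_i - 'X_j) * q by rewrite -Dq; ring.
  ring.
have D1 : D 1 by exists 0; rewrite msym1 mulr0 subrr.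
have DZ c q : D q -> D (c *: q).
  by move=> [a Ha]; exists (c *: a); rewrite msymZ -scalerAr -Ha scalerBr.
have DD q1 q2 : D q1 -> D q2 -> D (q1 + q2).
  move=> [a Ha] [b Hb]; exists (a + b); rewrite msymD mulrDr -Ha -Hb; ring.
have DM q1 q2 : D q1 -> D q2 -> D (q1 * q2).
  move=> [a Ha] [b Hb]; exists (a * q2 + msym (tperm i j) q1 * b).
  rewrite msymM mulrDr mulrA -Ha mulrCA -Hb; ring.
have DX k : D 'X_k.
  rewrite /D msym_var.
  case: tpermP => [->|->|_ _]; [exists 1 | exists (-1) | exists 0]; ring.
elim/mpolyind: p => [|c m q _ _ Dq].
  by exists 0; rewrite msym0 mulr0 subrr.
apply: (DD _ _ _ Dq); apply: DZ.
rewrite mpolyXE_id; elim/big_ind: _ => // k _.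
by elim: (m k) => // e IH; rewrite exprS; apply: DM.
Qed.

(* pi_i is demazure_pi i j for consecutive i and j.  The quotient exists by
   demazure_pi_exists, and it is unique by demazure_pi_uniq. *)
Definition demazure_pi i j p : {mpoly rat[n]} :=
  locked (xchoose (demazure_pi_exists i j p)).

Lemma demazure_piP i j p :
  ('X_i - 'X_j) * demazure_pi i j p = 'X_i * p - 'X_j * msym (tperm i j) p.
Proof.
rewrite /demazure_pi -lock.
exact/eqP/(xchooseP (demazure_pi_exists i j p)).
Qed.

Lemma subX_neq0 i j : i != j -> 'X_i - 'X_j != 0 :> {mpoly rat[n]}.
Proof.
move=> ne; apply/eqP=> /mpolyP/(_ U_(i)%MM).
rewrite mcoeffB mcoeff0 !mcoeffX eqxx.
have -> : (U_(j) == U_(i) :> 'X_{1..n})%MM = false.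
  by apply/eqP=> /mnmP/(_ j); rewrite !mnm1E eqxx (negbTE ne).
by rewrite subr0 => /eqP; rewrite oner_eq0.
Qed.

Lemma demazure_pi_uniq i j p q : i != j ->
  ('X_i - 'X_j) * q = 'X_i * p - 'X_j * msym (tperm i j) p ->
  demazure_pi i j p = q.
Proof.
by move=> /subX_neq0 ne; rewrite -demazure_piP => /(mulfI ne) ->.
Qed.

Lemma msym_tpermJ s i j p :
  msym s (msym (tperm i j) p) = msym (tperm (s i) (s j)) (msym s p).
Proof. by rewrite -!msymMm -tpermJ -conjgC. Qed.

Lemma msym_pi s i j p : i != j ->
  msym s (demazure_pi i j p) = demazure_pi (s i) (s j) (msym s p).
Proof.
move=> ne; apply/esym/demazure_pi_uniq; first by rewrite (inj_eq perm_inj).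
move/(congr1 (msym s)): (demazure_piP i j p).
by rewrite msymM !msymB !msymM !msym_var msym_tpermJ.
Qed.

Lemma msym_pi_id i j p : i != j ->
  msym (tperm i j) (demazure_pi i j p) = demazure_pi i j p.
Proof.
move=> ne; rewrite (msym_pi _ _ ne) tpermL tpermR.
apply: demazure_pi_uniq; first by rewrite eq_sym.
have := demazure_piP i j p.
rewrite -msymMm (tpermC j i) tperm2 msym1m => E.
by rewrite -opprB mulNr E opprB.
Qed.

Lemma demazure_pi_comm i j k l p :
  i != j -> k != l -> i != k -> i != l -> j != k -> j != l ->
  demazure_pi i j (demazure_pi k l p) = demazure_pi k l (demazure_pi i j p).
Proof.
move=> ij kl ik il jk jl; apply: (demazure_pi_uniq ij).
have tk : tperm i j k = k by rewrite tpermD.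
have tl : tperm i j l = l by rewrite tpermD.
have ti : tperm k l i = i by rewrite tpermD // eq_sym.
have tj : tperm k l j = j by rewrite tpermD // eq_sym.
rewrite (msym_pi _ _ kl) tk tl; apply: (mulfI (subX_neq0 kl)).
have E1 := demazure_piP k l (demazure_pi i j p).
rewrite (msym_pi _ _ ij) ti tj in E1.
have E2 := demazure_piP i j p; have E3 := demazure_piP i j (msym (tperm k l) p).
have E4 := demazure_piP k l p; have E5 := demazure_piP k l (msym (tperm i j) p).
have C : msym (tperm i j) (msym (tperm k l) p) =
         msym (tperm k l) (msym (tperm i j) p).
  by rewrite (msym_tpermJ (tperm i j)) tk tl.
rewrite -C in E5 *; rewrite mulrCA {}E1.
set u1 := demazure_pi k l p in E4 *; set u2 := demazure_pi k l _ in E5 *.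
set v1 := demazure_pi i j p in E2 *; set v2 := demazure_pi i j _ in E3 *.
set w1 := msym _ p in E2 E5 *; set w2 := msym _ p in E3 E4 *.
set w3 := msym _ _ in E3 E5 *; clearbody u1 u2 v1 v2 w1 w2 w3.
transitivity ('X_k * (('X_i - 'X_j) * v1) - 'X_l * (('X_i - 'X_j) * v2)).
  by ring.
rewrite E2 E3.
transitivity ('X_i * (('X_k - 'X_l) * u1) - 'X_j * (('X_k - 'X_l) * u2)).
  by rewrite E4 E5; ring.
by ring.
Qed.

Lemma demazure_pi_braid i j k p : i != j -> j != k -> i != k ->
  demazure_pi i j (demazure_pi j k (demazure_pi i j p)) =
  demazure_pi j k (demazure_pi i j (demazure_pi j k p)).
Proof.
move=> ij jk ik.
have ki : k != i by rewrite eq_sym.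
have sk : tperm i j k = k by rewrite tpermD // eq_sym.
have ti : tperm j k i = i by rewrite tpermD // eq_sym.
pose s p' : {mpoly rat[n]} := msym (tperm i j) p'.
pose t p' : {mpoly rat[n]} := msym (tperm j k) p'.
have sts : s (t (s p)) = t (s (t p)).
  rewrite /s /t [LHS]msym_tpermJ [RHS]msym_tpermJ tpermR sk tpermL ti.
  by rewrite -!(msymMm p) !tperm2.
set a : {mpoly rat[n]} := 'X_i; set b : {mpoly rat[n]} := 'X_j.
set c : {mpoly rat[n]} := 'X_k.
have sa : s a = b by rewrite /s msym_var tpermL.
have sb : s b = a by rewrite /s msym_var tpermR.
have sc : s c = c by rewrite /s msym_var sk.
have ta : t a = a by rewrite /t msym_var ti.
have tb : t b = c by rewrite /t msym_var tpermL.
have tc : t c = b by rewrite /t msym_var tpermR.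
have ne : (a - b) * (a - c) * (b - c) != 0.
  by rewrite !mulf_neq0 ?subX_neq0.
have sB q1 q2 : s (q1 - q2) = s q1 - s q2 by exact: msymB.
have tB q1 q2 : t (q1 - q2) = t q1 - t q2 by exact: msymB.
have sM q1 q2 : s (q1 * q2) = s q1 * s q2 by exact: msymM.
have tM q1 q2 : t (q1 * q2) = t q1 * t q2 by exact: msymM.
pose P := demazure_pi i j; pose Q := demazure_pi j k.
have PE q : (a - b) * P q = a * q - b * s q by exact: demazure_piP.
have QE q : (b - c) * Q q = b * q - c * t q by exact: demazure_piP.
have sP q : s (P q) = P q by exact: msym_pi_id.
have tQ q : t (Q q) = Q q by exact: msym_pi_id.
rewrite -/P -/Q; clearbody P Q a b c s t.
have sE q1 q2 q3 q4 q5 q6 : q1 * q2 = q3 * q4 - q5 * q6 ->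
    s q1 * s q2 = s q3 * s q4 - s q5 * s q6.
  by move/(congr1 s); rewrite sB !sM.
have tE q1 q2 q3 q4 q5 q6 : q1 * q2 = q3 * q4 - q5 * q6 ->
    t q1 * t q2 = t q3 * t q4 - t q5 * t q6.
  by move/(congr1 t); rewrite tB !tM.
have G1 := PE p; have G2 := QE (P p); have G3 := PE (Q (P p)).
have tG1 := tE _ _ _ _ _ _ G1; rewrite tB ta tb in tG1.
have stG1 := sE _ _ _ _ _ _ tG1; rewrite sB sa sc in stG1.
have sG2 := sE _ _ _ _ _ _ G2; rewrite sB sb sc sP in sG2.
have H1 := QE p; have H2 := PE (Q p); have H3 := QE (P (Q p)).
have sH1 := sE _ _ _ _ _ _ H1; rewrite sB sb sc in sH1.
have tsH1 := tE _ _ _ _ _ _ sH1; rewrite tB ta tc -sts in tsH1.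
have tH2 := tE _ _ _ _ _ _ H2; rewrite tB ta tb tQ in tH2.
apply: (mulfI ne).
exact: braid_calc G1 tG1 stG1 G2 sG2 G3 H1 sH1 tsH1 H2 tH2 H3.
Qed.

End DemazureOperator.

Section DemazureCharacter.
Variable n : nat.
Implicit Types (i j k l : 'I_n) (m : 'X_{1..n}).

Definition mnm_swap i j m : 'X_{1..n} := [multinom m (tperm i j l) | l < n].

Definition ascents m : {set 'I_n * 'I_n} :=
  [set u : 'I_n * 'I_n | (u.1 < u.2)%N & (m u.1 < m u.2)%N].

Fixpoint demazure_rec (N : nat) m : {mpoly rat[n]} :=
  if N is N'.+1 then
    if [pick u : 'I_n * 'I_n | (u.1.+1 == u.2 :> nat) && (m u.1 < m u.2)%N]
      is Some u
    then demazure_pi u.1 u.2 (demazure_rec N' (mnm_swap u.1 u.2 m))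
    else 'X_[m]
  else 'X_[m].

(* #|ascents m| drops by one at each step of the recursion, so the fuel never
   runs out.  The lemmas demazure_dominant and demazure_step are the defining
   recursion, for every choice of the position i. *)
Definition demazure m : {mpoly rat[n]} := demazure_rec #|ascents m| m.

Lemma mnm_swapE i j m l : mnm_swap i j m l = m (tperm i j l).
Proof. by rewrite mnmE. Qed.

Lemma demazure_dominant m :
  (forall i j, i.+1 = j :> nat -> (m j <= m i)%N) -> demazure m = 'X_[m].
Proof.
move=> dom; rewrite /demazure; case: #|_| => //= N.
case: pickP => // u /andP[/eqP /dom]; rewrite leqNgt => /negbTE ->.
by [].
Qed.

Lemma ascents_swap i j m : i.+1 = j :> nat -> (m i < m j)%N ->
  #|ascents m| = #|ascents (mnm_swap i j m)|.+1.
Proof.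
move=> ij lt; rewrite (cardsD1 (i, j)) inE /= -ij ltnSn lt add1n.
congr _.+1; pose f (u : 'I_n * 'I_n) := (tperm i j u.1, tperm i j u.2).
have fK : involutive f by case=> x y; rewrite /f /= !tpermK.
rewrite -(card_imset _ (inv_inj fK)) (can_imset_pre _ fK).
apply: eq_card => -[x y]; rewrite !inE /f /= !mnm_swapE xpair_eqE -!val_eqE /=.
have nE (u v : 'I_n) : u <> v -> (u : nat) <> v by move=> ne /val_inj.
case: tpermP => [ex|ex|/nE nxi /nE nxj];
  case: tpermP => [ey|ey|/nE nyi /nE nyj]; try subst x; try subst y; lia.
Qed.

Lemma demazure_step i j m : i.+1 = j :> nat -> (m i < m j)%N ->
  demazure m = demazure_pi i j (demazure (mnm_swap i j m)).
Proof.
have [N] := ubnP #|ascents m|; elim: N m i j => // N IH m i j leN ij lt.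
have [i0 [j0 [ij0 lt0 ->]]] : exists i0 j0, [/\ i0.+1 = j0 :> nat,
    (m i0 < m j0)%N &
    demazure m = demazure_pi i0 j0 (demazure (mnm_swap i0 j0 m))].
  rewrite {1}/demazure (ascents_swap ij lt) /=; case: pickP => [[i0 j0]|no].
    move=> /= /andP[/eqP ij0 lt0]; exists i0, j0; split=> [||]; [by []|by []|].
    rewrite /demazure; have := ascents_swap ij0 lt0.
    by rewrite (ascents_swap ij lt) => -[->].
  by have := no (i, j); rewrite /= ij eqxx lt.
have {}IH k l m' : (#|ascents m'| < #|ascents m|)%N -> k.+1 = l :> nat ->
    (m' k < m' l)%N ->
    demazure m' = demazure_pi k l (demazure (mnm_swap k l m')).
  by move=> lt_m'; apply: IH; apply: leq_trans lt_m' _.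
have asc k l m' : k.+1 = l :> nat -> (m' k < m' l)%N ->
    (#|ascents (mnm_swap k l m')| < #|ascents m'|)%N.
  by move=> kl mkl; rewrite (ascents_swap kl mkl).
have adj k l : k.+1 = l :> nat -> k != l.
  by move=> kl; rewrite -val_eqE /= -kl neq_ltn ltnSn.
clear leN; wlog : i j i0 j0 ij lt ij0 lt0 / (i0 <= i)%N.
  by move=> W; case: (leqP i0 i) => [|/ltnW] le; [|symmetry]; apply: W.
rewrite leq_eqVlt => /orP[/eqP/val_inj e|lt_i].
  by subst i0; have -> : j0 = j by apply: val_inj; rewrite /= -ij -ij0.
move: lt_i; rewrite ij0 leq_eqVlt => /orP[/eqP/val_inj e|lt_i].
  subst j0; have ne0 := adj _ _ ij0; have ne := adj _ _ ij.
  have nei : i0 != j by rewrite -val_eqE /= -ij -ij0 neq_ltn ltnW.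
  have [ne0' ne' nei'] : [/\ i != i0, j != i & j != i0].
    by split; rewrite eq_sym.
  have T1 : tperm i0 i j = j by rewrite tpermD.
  have T2 : tperm i j i0 = i0 by rewrite tpermD.
  have swE := (mnm_swapE, tpermL, tpermR, T1, T2).
  set m1 := mnm_swap i0 i m; set m2 := mnm_swap i j m.
  have lt1 : (m1 i < m1 j)%N by rewrite !swE // (ltn_trans lt0).
  have lt2 : (m2 i0 < m2 i)%N by rewrite !swE // (ltn_trans lt0).
  have A1 : (#|ascents m1| < #|ascents m|)%N by apply: asc.
  have A2 : (#|ascents m2| < #|ascents m|)%N by apply: asc.
  rewrite (IH _ _ m1 A1 ij lt1) (IH _ _ m2 A2 ij0 lt2).
  have lt11 : (mnm_swap i j m1 i0 < mnm_swap i j m1 i)%N by rewrite !swE.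
  have lt22 : (mnm_swap i0 i m2 i < mnm_swap i0 i m2 j)%N by rewrite !swE.
  rewrite (IH _ _ _ (ltn_trans (asc _ _ _ ij lt1) A1) ij0 lt11).
  rewrite (IH _ _ _ (ltn_trans (asc _ _ _ ij0 lt2) A2) ij lt22).
  suff E : mnm_swap i0 i (mnm_swap i j m1) = mnm_swap i j (mnm_swap i0 i m2).
    by rewrite -E; exact: demazure_pi_braid _ ne0 ne nei.
  apply/mnmP=> l; rewrite !mnm_swapE; congr (m _).
  have [->|li0] := eqVneq l i0; first by rewrite !swE.
  have [->|li] := eqVneq l i; first by rewrite !swE.
  have [->|lj] := eqVneq l j; first by rewrite !swE.
  by rewrite !tpermD // eq_sym.
have [n1 n2 n3 n4] : [/\ i0 != i, i0 != j, j0 != i & j0 != j].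
  by rewrite -!val_eqE /=; split; lia.
have ne0 := adj _ _ ij0; have ne := adj _ _ ij.
have [n1' n2' n3' n4'] : [/\ i != i0, j != i0, i != j0 & j != j0].
  by split; rewrite eq_sym.
have T1 : tperm i0 j0 i = i by rewrite tpermD.
have T2 : tperm i0 j0 j = j by rewrite tpermD.
have T3 : tperm i j i0 = i0 by rewrite tpermD.
have T4 : tperm i j j0 = j0 by rewrite tpermD.
have swE := (mnm_swapE, tpermL, tpermR, T1, T2, T3, T4).
set m1 := mnm_swap i0 j0 m; set m2 := mnm_swap i j m.
have lt1 : (m1 i < m1 j)%N by rewrite !swE.
have lt2 : (m2 i0 < m2 j0)%N by rewrite !swE.
rewrite (IH _ _ m1 (asc _ _ _ ij0 lt0) ij lt1).
rewrite (IH _ _ m2 (asc _ _ _ ij lt) ij0 lt2).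
suff E : mnm_swap i j m1 = mnm_swap i0 j0 m2.
  by rewrite -E; exact/esym/(demazure_pi_comm _ ne ne0 n1' n3' n2' n4').
apply/mnmP=> l; rewrite !mnm_swapE; congr (m _).
have [->|li0] := eqVneq l i0; first by rewrite !swE.
have [->|lj0] := eqVneq l j0; first by rewrite !swE.
have [->|li] := eqVneq l i; first by rewrite !swE.
have [->|lj] := eqVneq l j; first by rewrite !swE.
by rewrite !tpermD // eq_sym.
Qed.

End DemazureCharacter.

(* The entry of index i - 1 of the first list is h_{k+i}(x_i, ..., x_n). *)
Definition groebner_polys (n k r : nat) : seq {mpoly rat[n]} :=
  [seq hsym (k + i.+1) [set j : 'I_n | (i <= j)%N] | i : 'I_n] ++
  [seq mpoly_rev (demazure (mnm_rev (skip_vector A)))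
     | A : {set 'I_n} <- enum {set 'I_n} & #|A| == (n - r + 1)%N].

(* Main.v *)
Require Import Defs.
From mathcomp Require Import all_boot all_order all_fingroup all_algebra.
From mathcomp Require Import zify ring.

(** Put d = n - r + 1. Call a monomial standard if it is divisible neither by
    a power x_i^(k+i) nor by a monomial x^gamma(S) with S of size d. These
    divisors are the leading monomials of the listed polynomials, which are
    monic, homogeneous and belong to the ideal. The point is that no standard
    monomial is the leading monomial of an element of the ideal
    ([ideal_lead_divisible]).

    The Demazure characters enter through a determinant. The reversed vector
    of gamma(S) has weakly decreasing nonzero entries lam_1, ..., lam_d, at
    places phi_1 < ... < phi_d, with zeros interspersed. Demazure operators
    that move the zeros to the left act on one row of a Jacobi-Trudi matrix at
    a time, which gives ([demazure_flagged_jt])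
      kappa = det (h_(lam_i - i + j) (x_1, ..., x_(phi_i))).
    The diagonal term of the determinant provides the leading monomial
    ([monic_at_flagged_jt]). For the membership in the ideal, combine the
    columns with the signed elementary symmetric polynomials of all variables.
    Modulo e_d, ..., e_n the generating polynomial of the e_j has degree less
    than d, so row i becomes a coefficient of the product of the 1 - x_l t
    over l > phi_i. As lam_i is one more than the number of zeros after its
    place, the degree of this coefficient exceeds the number of factors, and
    the whole combined column is zero ([det_flagged_jt_ideal]).

    That standard monomials are independent modulo the ideal is shown by
    deforming the ideal to that of a finite set of points. Take k + n distinct
    numbers, r of them marked, and let Y be the set of injective n-tuples of
    these numbers that contain all the marked ones. Every homogeneous element
    of the ideal is the component of top degree of a polynomial vanishing on Y
    ([ideal_deformable]): for h_(k+i) divide the product of the 1 - a t over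
    all k + n numbers a by the product of the 1 - x_j t, which leaves k
    factors; for e_j with j > n - r divide the product of the 1 - x_j t by
    that over the marked numbers, which leaves n - r factors. On Y, standard
    monomials are linearly independent ([standard_independent]). This is an
    instance of the lex game: seen as a polynomial in x_1, a combination of
    standard monomials of degree J in x_1 is determined by its values, because
    over the relevant tails (x_2, ..., x_n) there are more than J points of Y,
    and its top coefficient is a combination of the same kind on a smaller
    set.

    Now let f be in the ideal with standard leading monomial u. A component of
    f deforms to a polynomial vanishing on Y with leading monomial u. Division
    of its other terms by the deformed basis polynomials leaves a combination
    of standard monomials that vanishes on Y and contains u, which is absurd. *)

Set Implicit Arguments.
Unset Strict Implicit.
Unset Printing Implicit Defensive.

Import Order.TTheory GRing.Theory Num.Theory.
Local Open Scope ring_scope.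

(** * Complete symmetric polynomials of a list *)

Section SymmetricSequences.
Variable R : comNzRingType.
Implicit Types (a b : R) (s t u : seq R).

(** The complete homogeneous symmetric polynomials, split according to the
    power of the first entry. They are taken on lists because the same
    identities are needed for variables and for the coordinates of points. *)
Fixpoint csym s : nat -> R :=
  if s is a :: s' then fun m => \sum_(i < m.+1) a ^+ i * csym s' (m - i)
  else fun m => (m == 0)%:R.

(** The coefficient of degree m is (-1)^m e_m; the sign is kept so that [epoly
    s] is the inverse of the generating series of [csym s]. *)
Definition epoly s : {poly R} := \prod_(a <- s) (1 - a *: 'X).

(** The coefficient of degree m in the product of [epoly t] with the
    generating series of [csym s], that is, in the quotient of the products of
    the factors 1 - a X over [t] and over [s]. *)
Definition econv t s m : R := \sum_(i < m.+1) (epoly t)`_i * csym s (m - i).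

Lemma csym0 s : csym s 0 = 1.
Proof. by elim: s => //= a s IH; rewrite big_ord1 mul1r IH. Qed.

Lemma csym_cons a s m : csym (a :: s) m.+1 = csym s m.+1 + a * csym (a :: s) m.
Proof.
rewrite /= big_ord_recl expr0 mul1r subn0 big_distrr /=; congr (_ + _).
by apply: eq_bigr => i _; rewrite exprS mulrA.
Qed.

Lemma csym_nil m : csym [::] m = (m == 0)%:R.
Proof. by []. Qed.

Local Arguments csym : simpl never.

Lemma epoly_coef0 s : (epoly s)`_0 = 1.
Proof.
rewrite /epoly; elim: s => [|a s IH]; first by rewrite big_nil coef1.
by rewrite big_cons mulrBl mul1r coefB -scalerAl coefZ coefXM mulr0 subr0.
Qed.

Lemma epoly_cons a s m :
  (epoly (a :: s))`_m.+1 = (epoly s)`_m.+1 - a * (epoly s)`_m.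
Proof. by rewrite /epoly big_cons mulrBl mul1r coefB -scalerAl coefZ coefXM. Qed.

Lemma size_epoly s : (size (epoly s) <= (size s).+1)%N.
Proof.
rewrite /epoly; elim: s => [|a s IH]; first by rewrite big_nil size_poly1.
rewrite big_cons; apply: leq_trans (size_polyMleq _ _) _.
have: (size (1 - a *: 'X : {poly R})%R <= 2)%N.
  apply: leq_trans (size_polyD _ _) _; rewrite size_polyN size_poly1 geq_max /=.
  by apply: leq_trans (size_scale_leq _ _) _; rewrite size_polyX.
by move: IH => /=; lia.
Qed.

Lemma epoly_gt_size s m : (size s < m)%N -> (epoly s)`_m = 0.
Proof. by move=> lt; rewrite nth_default // (leq_trans (size_epoly s)). Qed.

Lemma perm_epoly s t : perm_eq s t -> epoly s = epoly t.
Proof. exact: perm_big. Qed.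

Lemma perm_econv t u s m : perm_eq t u -> econv t s m = econv u s m.
Proof. by rewrite /econv => /perm_epoly ->. Qed.

Lemma econv0 t s : econv t s 0 = 1.
Proof. by rewrite /econv big_ord1 epoly_coef0 csym0 mulr1. Qed.

Lemma econv_consl a t s m :
  econv (a :: t) s m.+1 = econv t s m.+1 - a * econv t s m.
Proof.
rewrite /econv big_ord_recl [in RHS]big_ord_recl !epoly_coef0 -addrA.
congr (_ + _); rewrite big_distrr -sumrB /=; apply: eq_bigr => i _.
by rewrite /bump !add1n epoly_cons subSS; ring.
Qed.

Lemma econv_consr a t s m :
  econv t (a :: s) m.+1 = econv t s m.+1 + a * econv t (a :: s) m.
Proof.
rewrite /econv big_ord_recr [in RHS]big_ord_recr /= subnn !csym0.
rewrite addrAC; congr (_ + _).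
rewrite big_distrr -big_split /=; apply: eq_bigr => i _.
have le_im : (i <= m)%N by rewrite -ltnS.
by rewrite subSn // csym_cons; ring.
Qed.

Lemma econv_cancel1 a t s m : econv (a :: t) (a :: s) m = econv t s m.
Proof.
case: m => [|m]; first by rewrite !econv0.
by rewrite econv_consl econv_consr; ring.
Qed.

(** A common factor of numerator and denominator cancels. All vanishing
    statements below come from this: if [s] is part of [t], then [econv t s]
    is a coefficient of a polynomial whose degree is the number of remaining
    entries. *)
Lemma econv_cancel u t s m : econv (u ++ t) (u ++ s) m = econv t s m.
Proof. by elim: u => //= a u IH; rewrite econv_cancel1. Qed.

Lemma econv_nil s m : econv [::] s m = csym s m.
Proof.
rewrite /econv big_ord_recl epoly_coef0 mul1r subn0 big1 ?addr0 // => i _.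
by rewrite epoly_gt_size ?mul0r.
Qed.

Lemma econv_empty t m : econv t [::] m = (epoly t)`_m.
Proof.
rewrite /econv big_ord_recr /= subnn csym0 mulr1 big1 ?add0r // => i _.
by rewrite csym_nil (_ : (m - i == 0)%N = false) ?mulr0 //; have := ltn_ord i; lia.
Qed.

(** [econv s s] is 1, which determines [csym s] recursively from [epoly s].
    This gives the symmetry of [csym], as [epoly] is visibly symmetric. *)
Lemma csym_uniq s t m : epoly s = epoly t -> csym s m = csym t m.
Proof.
have H u k : csym u k =
    (k == 0)%:R - \sum_(i < k) (epoly u)`_i.+1 * csym u (k - i.+1).
  have <- : econv u u k = (k == 0)%:R.
    by rewrite -{1 2}(cats0 u) econv_cancel econv_nil.
  rewrite /econv big_ord_recl epoly_coef0 mul1r subn0; ring.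
move=> E; elim/ltn_ind: m => m IH; rewrite H [RHS]H E.
congr (_ - _); apply: eq_bigr => i _; rewrite IH //; have := ltn_ord i; lia.
Qed.

Lemma perm_csym s t : perm_eq s t -> csym s =1 csym t.
Proof. by move=> /perm_epoly E m; apply: csym_uniq. Qed.

(** Both orders of adjoining [a] and [b] to [s] express the same polynomial;
    the combination of the two recursions eliminates it. For consecutive
    variables this says that the Demazure operator adjoins a variable to a
    complete symmetric polynomial. *)
Lemma csym_divdiff a b s m :
  (a - b) * csym (a :: b :: s) m = a * csym (a :: s) m - b * csym (b :: s) m.
Proof.
case: m => [|m]; first by rewrite !csym0; ring.
have P : csym (b :: a :: s) =1 csym (a :: b :: s).
  by apply: perm_csym; rewrite -(cat1s b) -(cat1s a) perm_catCA.
have E1 := csym_cons a (b :: s) m; have E2 := csym_cons b (a :: s) m.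
rewrite !P in E2; rewrite mulrBl {1}E2 E1; ring.
Qed.

(** Polynomials of negative degree are 0. *)
Definition csym_shift s i j : R := if (j <= i)%N then csym s (i - j) else 0.

Lemma econv_shift t s i j K : (i < K)%N ->
  \sum_(l < K) (epoly t)`_l * (if (l <= i)%N then csym_shift s (i - l) j else 0) =
  if (j <= i)%N then econv t s (i - j) else 0.
Proof.
move=> ltK; case: ifP => ji; last first.
  rewrite big1 // => l _; case: ifP => li; last by rewrite mulr0.
  by rewrite /csym_shift (_ : (j <= i - l)%N = false) ?mulr0 //; lia.
rewrite /econv (big_ord_widen K (fun l => (epoly t)`_l * csym s (i - j - l))%R);
  last by lia.
rewrite [RHS]big_mkcond; apply: eq_bigr => l _; rewrite /csym_shift.
have -> : (l < (i - j).+1)%N = ((l <= i) && (j <= i - l))%N by lia.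
case: ifP => //= li; last by rewrite mulr0.
by case: ifP => //= jl; rewrite ?mulr0 // subnAC.
Qed.

End SymmetricSequences.

Arguments csym : simpl never.

Lemma rmorph_csym (R S : comNzRingType) (f : {rmorphism R -> S}) s m :
  f (csym s m) = csym (map f s) m.
Proof.
elim: s m => [|a s IH] m; first by rewrite !csym_nil rmorph_nat.
rewrite rmorph_sum; apply: eq_bigr => i _.
by rewrite rmorphM rmorphXn IH.
Qed.

Lemma rmorph_csym_shift (R S : comNzRingType) (f : {rmorphism R -> S}) s i j :
  f (csym_shift s i j) = csym_shift (map f s) i j.
Proof. by rewrite /csym_shift; case: ifP; rewrite ?rmorph0 // rmorph_csym. Qed.

Lemma rmorph_epoly (R S : comNzRingType) (f : {rmorphism R -> S}) s m :
  f (epoly s)`_m = (epoly (map f s))`_m.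
Proof.
elim: s m => [|a s IH] m /=; first by rewrite /epoly !big_nil !coef1 rmorph_nat.
case: m => [|m]; first by rewrite !epoly_coef0 rmorph1.
by rewrite !epoly_cons rmorphB rmorphM !IH.
Qed.

(** * Symmetric polynomials in variables *)

Section Variables.
Variable n : nat.
Implicit Types (m : 'X_{1..n}) (s : seq 'I_n).

Definition vars s : seq {mpoly rat[n]} := [seq 'X_i | i <- s].

(** Distinct variables make every monomial appear once; the induction on the
    list splits according to whether its first variable divides the monomial. *)
Lemma mcoeff_csym_vars s d m : uniq s ->
  (csym (vars s) d)@_m =
  ((mdeg m == d) && [forall i, (m i != 0%N) ==> (i \in s)])%:R.
Proof.
elim: s d m => [|a s IH] d m.
  rewrite csym_nil => _.
  have -> : [forall i, (m i != 0%N) ==> (i \in [::])] = (m == 0%MM).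
    apply/forallP/eqP => [z|-> i]; last by rewrite mnm0E.
    by apply/mnmP=> i; rewrite mnm0E; apply/eqP; have := z i; rewrite implybF negbK.
  rewrite -mdeg_eq0; case: d => [|d].
    by rewrite mcoeff1 andbb mdeg_eq0.
  by rewrite mcoeff0; case: eqP => // ->.
case/andP=> as_ us; elim: d m => [|d IHd] m.
  rewrite csym0 mcoeff1 -mdeg_eq0; case: eqP => //= m0.
  suff -> : [forall i, (m i != 0%N) ==> (i \in a :: s)] by [].
  move/eqP: m0; rewrite mdeg_eq0 => /eqP ->.
  by apply/forallP=> i; rewrite mnm0E.
rewrite /= csym_cons mcoeffD IH // mulrC; case: (eqVneq (m a) 0%N) => [ma0|ma].
  have -> : (csym (vars (a :: s)) d * 'X_a)@_m = 0.
    apply/eqP; rewrite mcoeff_eq0 (perm_mem (msuppMX _ _)).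
    by apply/mapP=> -[m' _ mE]; move: ma0; rewrite mE mnmDE mnm1E eqxx.
  rewrite addr0; congr (_ && _)%:R; apply: eq_forallb => i.
  by rewrite inE; case: (eqVneq i a) => // ->; rewrite ma0.
have /submK mE : (U_(a) <= m)%MM by rewrite lep1mP.
rewrite -{3}mE addmC mcoeffMX IHd.
rewrite (_ : [forall i, (m i != 0%N) ==> (i \in s)] = false); last first.
  by apply/negbTE/forallPn; exists a; rewrite ma.
rewrite andbF add0r; congr (_ && _)%:R.
  by rewrite -{2}mE mdegD mdeg1 addn1.
apply: eq_forallb => i; rewrite mnmBE mnm1E inE.
by case: (eqVneq a i) => [_|]; rewrite ?implybT ?subn0.
Qed.

Lemma mcoeff_hsym d (A : {set 'I_n}) m :
  (hsym d A)@_m = ((mdeg m == d) && [forall i, (m i != 0%N) ==> (i \in A)])%:R.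
Proof.
rewrite /hsym raddf_sum /=.
case: (boolP (_ && _)) => mA; last first.
  rewrite big1 // => m' m'A; rewrite mcoeffX; case: eqP => // mE.
  by rewrite mE (negPf mA) in m'A.
have lt_md : (mdeg m < d.+1)%N by case/andP: mA => /eqP ->.
rewrite (bigD1 (BMultinom lt_md)) //= mcoeffX eqxx big1 ?addr0 // => m' /andP[_ ne].
by rewrite mcoeffX; case: eqP => // mE; case/eqP: ne; apply/val_inj.
Qed.

Lemma hsym_csym d s : uniq s -> hsym d [set i in s] = csym (vars s) d.
Proof.
move=> us; apply/mpolyP=> m; rewrite mcoeff_hsym mcoeff_csym_vars //.
by congr (_ && _)%:R; apply: eq_forallb => i; rewrite inE.
Qed.

(** Expanding the product of the factors 1 - x_i X over all variables, a set
    of chosen factors contributes the product of its variables. *)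
Lemma epoly_vars j : (epoly (vars (enum 'I_n)))`_j = (-1) ^+ j * mesym n rat j.
Proof.
have -> : epoly (vars (enum 'I_n)) =
    \sum_(h : {set 'I_n}) (\prod_(i in h) (- 'X_i)) *: 'X^#|h|.
  rewrite /epoly big_map big_enum /=.
  under eq_bigr do rewrite addrC -scaleNr.
  rewrite bigA_distr /=; apply: eq_bigr => h _.
  by rewrite -big_mkcond scaler_prod prodr_const.
rewrite coef_sum /mesym big_distrr [RHS]big_mkcond /=; apply: eq_bigr => h _.
rewrite coefZ coefXn eq_sym; case: eqP => [<-|]; rewrite ?mulr0 // mulr1.
by rewrite prodrN.
Qed.
End Variables.

(** * Flagged Jacobi-Trudi determinants *)

Section FlaggedJacobiTrudi.
Variables (R : comNzRingType) (d : nat).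
Implicit Types (w s t : seq R) (lam phi : 'I_d -> nat).

(** The Jacobi-Trudi matrix of the flagged Schur function with partition [lam]
    and flag [phi]. *)
Definition flagged_jt w lam phi : 'M[R]_d :=
  \matrix_(i, j) csym_shift (take (phi i) w) (lam i + j) i.

(** The column whose entry l is the signed e_(j-l). As a column operation on
    [flagged_jt] it convolves complete with elementary symmetric polynomials. *)
Definition ecol t (j : nat) (l : nat) : R :=
  if (l <= j)%N then (epoly t)`_(j - l) else 0.

(** A row of a flagged determinant only reaches the coefficients of [epoly t]
    up to degree j; the sum on the right is what the full convolution has in
    addition. *)
Lemma csym_shift_ecol t s a i (j : 'I_d) : (i <= a + j)%N ->
  \sum_(l < d) csym_shift s (a + l) i * ecol t j l =
  econv t s (a + j - i) -
  \sum_(l < a) (epoly t)`_(j.+1 + l) * csym_shift s (a - l.+1) i.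
Proof.
move=> le_i; have := econv_shift t s i (ltnSn (a + j)); rewrite le_i => <-.
rewrite addnC -addSn big_split_ord /= [X in _ = _ + X - _](_ : _ =
    \sum_(l < a) (epoly t)`_(j.+1 + l) * csym_shift s (a - l.+1) i); last first.
  apply: eq_bigr => l _; have := ltn_ord l => lt_l.
  by rewrite ifT; [congr (_ * csym_shift _ _ _)|]; lia.
rewrite addrK; pose F l := csym_shift s (a + l) i * (epoly t)`_(j - l).
transitivity (\sum_(l < j.+1) F l).
  rewrite [RHS](big_ord_widen d F); last exact: ltn_ord.
  rewrite [RHS]big_mkcond; apply: eq_bigr => l _.
  by rewrite /ecol ltnS; case: ifP; rewrite ?mulr0.
rewrite (reindex_inj rev_ord_inj); apply: eq_bigr => l _ /=.
have := ltn_ord l => lt_l; rewrite /F mulrC ifT; last by lia.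
by congr (_`_ _ * csym_shift _ _ _); lia.
Qed.

(** When row i uses the first i + 1 entries of [w], multiplication by the
    unitriangular matrix with columns [ecol (take j w) j] leaves a lower
    triangular matrix: above the diagonal an entry is a coefficient of a
    polynomial in a degree beyond that of the polynomial, and on the diagonal
    only the factor of w_i does not cancel. *)
Lemma det_flagged_jt_dominant w lam phi :
  (forall i : 'I_d, phi i = i.+1) -> (d <= size w)%N ->
  \det (flagged_jt w lam phi) = \prod_(i < d) w`_i ^+ lam i.
Proof.
move=> phiE le_d.
pose U : 'M[R]_d := \matrix_(l, j) ecol (take j w) j l.
have detU : \det U = 1.
  rewrite -det_tr det_trig; last first.
    apply/is_trig_mxP => i j lt_ij; rewrite !mxE /ecol ifF //; lia.
  by apply: big1 => i _; rewrite !mxE /ecol leqnn subnn epoly_coef0.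
have MU (i j : 'I_d) : (i <= j)%N -> (flagged_jt w lam phi *m U) i j =
    if i == j then w`_i ^+ lam i else 0.
  move=> le_ij; rewrite !mxE.
  under eq_bigr do rewrite !mxE.
  have size_t : (size (take j w) <= j)%N by rewrite size_take; case: ifP => //; lia.
  rewrite csym_shift_ecol; last by lia.
  rewrite [X in _ - X]big1 ?subr0 => [|l _]; last first.
    by rewrite epoly_gt_size ?mul0r //; lia.
  have lt_i : (i < size w)%N by apply: leq_trans le_d.
  rewrite phiE; case: eqP => [<-|ne].
    rewrite addnK (take_nth 0) // -cats1 -{1}(cats0 (take i w)) econv_cancel.
    rewrite econv_nil; elim: (lam i) => [|m IH]; first by rewrite csym0.
    by rewrite csym_cons IH csym_nil add0r exprS.
  have lt_ij : (i < j)%N by rewrite ltn_neqAle le_ij andbT; apply/eqP=> /val_inj.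
  rewrite -{1}(cat_take_drop i.+1 (take j w)) take_takel //.
  rewrite -{2}(cats0 (take i.+1 w)) econv_cancel econv_empty epoly_gt_size //.
  by rewrite size_drop; lia.
have <- : \det (flagged_jt w lam phi *m U) = \det (flagged_jt w lam phi).
  by rewrite det_mulmx detU mulr1.
rewrite det_trig; last first.
  by apply/is_trig_mxP => i j lt_ij; rewrite (MU _ _ (ltnW lt_ij)) -val_eqE ltn_eqF.
by apply: eq_bigr => i _; rewrite MU ?eqxx.
Qed.

(** Combine the columns of the matrix with the signed elementary symmetric
    polynomials of all of [t]. Completed by the coefficients of degree at
    least d, row i would be a coefficient of the product of the factors 1 - a
    X over the entries after the first phi_i, and its degree exceeds their
    number. So the combination lies in J, and as the last column has
    coefficient 1, the adjugate matrix shows that the determinant does. *)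
Lemma det_flagged_jt_ideal (J : R -> Prop) t lam phi :
  (forall x y, J x -> J (y * x)) -> (forall x y, J x -> J y -> J (x + y)) -> J 0 ->
  (forall m, (d <= m)%N -> J (epoly t)`_m) -> (0 < d)%N ->
  (forall i : 'I_d, (size t + i.+1 < lam i + d + phi i)%N) ->
  (forall i, phi i <= size t)%N -> (forall i, 0 < lam i)%N ->
  J (\det (flagged_jt t lam phi)).
Proof.
move=> JM JD J0 Je d_gt0 len phit lam_gt0; set M := flagged_jt _ _ _.
have JB I r (P : pred I) F :
    (forall i, P i -> J (F i)) -> J (\sum_(i <- r | P i) F i).
  by move=> JF; elim/big_ind: _.
have lt_d : (d.-1 < d)%N by lia.
pose last_d := Ordinal lt_d.
pose c : 'cV[R]_d := \col_l ecol t d.-1 l.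
have Jb i : J ((M *m c) i 0).
  rewrite !mxE; under eq_bigr do rewrite !mxE.
  have lt_i := ltn_ord i; have pos := lam_gt0 i.
  rewrite (@csym_shift_ecol t _ _ _ last_d) /=; last by lia.
  rewrite -{1}(cat_take_drop (phi i) t) -{2}(cats0 (take (phi i) t)).
  rewrite econv_cancel econv_empty epoly_gt_size; last first.
    rewrite size_drop; have := len i; have := phit i; lia.
  rewrite sub0r -mulN1r; apply/JM/JB => l _; rewrite mulrC; apply/JM/Je; lia.
have -> : \det M = (\adj M *m (M *m c)) last_d 0.
  rewrite mulmxA mul_adj_mx mul_scalar_mx !mxE /ecol /= leqnn subnn.
  by rewrite epoly_coef0 mulr1.
by rewrite mxE; apply: JB => i _; apply: JM.
Qed.

(** The determinant is linear in row [i0], and the hypotheses say that this is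
    the only row where the three matrices differ. *)
Lemma det_flagged_jt_row w w' lam phi phi' i0 a b :
  (forall i, i != i0 ->
     phi i = phi' i /\ csym (take (phi i) w') =1 csym (take (phi i) w)) ->
  (forall m, (a - b) * csym (take (phi i0) w) m =
     a * csym (take (phi' i0) w) m - b * csym (take (phi' i0) w') m) ->
  (a - b) * \det (flagged_jt w lam phi) =
  a * \det (flagged_jt w lam phi') - b * \det (flagged_jt w' lam phi').
Proof.
move=> other row0; pose c i : R := if i == i0 then a - b else 1.
pose A := \matrix_(i, j) (c i * flagged_jt w lam phi i j).
have liftE i : c (lift i0 i) = 1 by rewrite /c eq_sym (negPf (neq_lift _ _)).
have {}other i := other (lift i0 i).
have -> : (a - b) * \det (flagged_jt w lam phi) = \det A.
  rewrite (@determinant_multilinear _ _ A (flagged_jt w lam phi)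
    (flagged_jt w lam phi) i0 (a - b) 0).
  - by rewrite mul0r addr0.
  - by apply/rowP=> j; rewrite !mxE /c eqxx mul0r addr0.
  - by apply/matrixP=> i j; rewrite !mxE liftE mul1r.
  - by apply/matrixP=> i j; rewrite !mxE liftE mul1r.
rewrite -mulNr; apply: (@determinant_multilinear _ _ A _ _ i0).
- apply/rowP=> j; rewrite !mxE /c eqxx mulNr /csym_shift.
  by case: ifP => _; rewrite ?mulr0 ?subrr.
- apply/matrixP=> i j; rewrite !mxE liftE mul1r.
  by have [|-> _] := other i; rewrite // eq_sym neq_lift.
- apply/matrixP=> i j; rewrite !mxE liftE mul1r /csym_shift.
  have [|<- E] := other i; first by rewrite eq_sym neq_lift.
  by case: ifP.
Qed.
End FlaggedJacobiTrudi.

Lemma map_flagged_jt (R S : comNzRingType) (f : {rmorphism R -> S}) d w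
    (lam phi : 'I_d -> nat) :
  map_mx f (flagged_jt w lam phi) = flagged_jt (map f w) lam phi.
Proof. by apply/matrixP=> i j; rewrite !mxE rmorph_csym_shift map_take. Qed.

(** * Demazure characters as determinants *)

Section DemazureDeterminant.
Variable n : nat.
Local Notation X := (vars (enum 'I_n)).

Lemma mem_take_enum (i : 'I_n) k : (i \in take k (enum 'I_n)) = (i < k)%N.
Proof.
rewrite -(mem_map val_inj) map_take val_enum_ord take_iota mem_iota /= add0n.
by rewrite leq_min ltn_ord andbT.
Qed.

Lemma size_allvars : size X = n.
Proof. by rewrite size_map size_enum_ord. Qed.

Lemma take_allvars k : take k X = vars (take k (enum 'I_n)).
Proof. by rewrite -map_take. Qed.

Lemma nth_allvars (p : 'I_n) : X`_p = 'X_p.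
Proof. by rewrite (nth_map p) ?size_enum_ord // nth_ord_enum. Qed.

Lemma takeS_allvars (p : 'I_n) : take p.+1 X = rcons (take p X) 'X_p.
Proof. by rewrite (take_nth 0) ?size_allvars // nth_allvars. Qed.

Lemma msym_vars s (L : seq 'I_n) : map (msym s) (vars L) = vars (map s L).
Proof. by rewrite /vars -!map_comp; apply: eq_map => i /=; rewrite msym_var. Qed.

(** Interchanging x_p and x_(p+1) permutes the first k variables unless k
    separates the two. *)
Lemma csym_msym_take (p q : 'I_n) k : p.+1 = q :> nat -> k != p.+1 ->
  csym (map (msym (tperm p q)) (take k X)) =1 csym (take k X).
Proof.
move=> pq ne; apply: perm_csym; rewrite take_allvars msym_vars; apply: perm_map.
have ue : uniq (take k (enum 'I_n)) by rewrite take_uniq ?enum_uniq.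
apply: uniq_perm => // [|i]; first by rewrite map_inj_uniq //; apply: perm_inj.
rewrite -{1}(tpermK p q i) mem_map; last exact: perm_inj.
rewrite !mem_take_enum; case: tpermP => // ->; lia.
Qed.

Lemma csym_take_step (p q : 'I_n) m : p.+1 = q :> nat ->
  ('X_p - 'X_q) * csym (take q.+1 X) m =
  'X_p * csym (take p.+1 X) m -
  'X_q * csym (map (msym (tperm p q)) (take p.+1 X)) m.
Proof.
move=> pq; have R s (a : {mpoly rat[n]}) : csym (rcons s a) =1 csym (a :: s).
  by apply: perm_csym; rewrite perm_rcons.
have R2 s (a b : {mpoly rat[n]}) : csym (rcons (rcons s a) b) =1 csym (a :: b :: s).
  apply: perm_csym; rewrite perm_rcons perm_sym -(cat1s a) -(cat1s b) perm_catCA /=.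
  by rewrite perm_cons perm_sym perm_rcons.
rewrite takeS_allvars -pq takeS_allvars R2 R map_rcons R csym_divdiff.
rewrite /= msym_var tpermL; congr (_ - _ * csym (_ :: _) _).
rewrite take_allvars msym_vars; congr vars; rewrite -[LHS]map_id.
apply/eq_in_map => i; rewrite mem_take_enum => lt_i.
by rewrite tpermD // -val_eqE /=; lia.
Qed.

(** By the last hypothesis, exactly one row is not symmetric in x_p and x_q,
    and on that row the operator adjoins x_q to the variables. *)
Lemma demazure_pi_flagged_jt d (lam phi phi' : 'I_d -> nat) (i0 : 'I_d)
    (p q : 'I_n) :
  p.+1 = q :> nat -> phi' i0 = p.+1 -> phi i0 = q.+1 ->
  (forall i, i != i0 -> phi i = phi' i /\ phi i != p.+1) ->
  demazure_pi p q (\det (flagged_jt X lam phi')) = \det (flagged_jt X lam phi).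
Proof.
move=> pq phi'i0 phii0 phiE; apply: demazure_pi_uniq.
  by rewrite -val_eqE /=; lia.
rewrite -[msym _ _]/((msym (tperm p q) : {rmorphism _ -> _}) _).
rewrite -det_map_mx map_flagged_jt /=; apply: det_flagged_jt_row => [i ne|m].
  have [<- ne1] := phiE i ne; split=> // m; rewrite -map_take.
  exact: csym_msym_take.
by rewrite phii0 phi'i0 (csym_take_step m pq) map_take.
Qed.


(** Places are counted from 1, as they also serve as numbers of variables. *)
Definition flag_mnm d (lam phi : 'I_d -> nat) : 'X_{1..n} :=
  [multinom (\sum_(i < d | phi i == l.+1) lam i)%N | l < n].

Lemma flag_mnmE d (lam phi : 'I_d -> nat) (i : 'I_d) (l : 'I_n) :
  injective phi -> phi i = l.+1 -> flag_mnm lam phi l = lam i.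
Proof.
move=> inj_phi phi_i; rewrite mnmE (big_pred1 i) // => j /=.
by rewrite -phi_i; apply/eqP/eqP=> [/inj_phi|->].
Qed.

Lemma flag_mnm0 d (lam phi : 'I_d -> nat) (l : 'I_n) :
  (forall i, phi i != l.+1) -> flag_mnm lam phi l = 0%N.
Proof. by move=> ne; rewrite mnmE big_pred0 // => i; apply/negbTE. Qed.

(** The least value has to be 1, and a gap between two consecutive values
    would need a further value inside it. *)
Lemma flag_initial d (phi : 'I_d -> nat) :
  (forall i j : 'I_d, (i < j)%N -> (phi i < phi j)%N) ->
  (forall i, 0 < phi i)%N ->
  (forall i, (1 < phi i)%N -> exists j, phi j = (phi i).-1) ->
  forall i : 'I_d, phi i = i.+1.
Proof.
move=> incr pos pred [i]; elim: i => [|i IH] lt_i.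
  have [le1|/pred[j phi_j]] := leqP (phi (Ordinal lt_i)) 1.
    by apply/eqP; rewrite eqn_leq le1 pos.
  have pos0 := pos (Ordinal lt_i); case: (posnP j) => [j0|j_gt0].
    have E : Ordinal lt_i = j by apply/val_inj.
    by rewrite E in pos0 phi_j *; lia.
  by have := incr (Ordinal lt_i) j j_gt0; lia.
have := IH (ltnW lt_i); set a := Ordinal _ => phi_a.
set b := Ordinal _; have lt_ab : (phi a < phi b)%N by apply: incr => /=.
have [j phi_j] : exists j, phi j = (phi b).-1 by apply: pred; lia.
have [lt_aj|lt_ja|E] := ltngtP a j.
- have [lt_bj|lt_jb|/val_inj E] := ltngtP b j.
  + by have := incr _ _ lt_bj; lia.
  + by move: lt_aj lt_jb => /=; lia.
  + by subst b; rewrite E in phi_j lt_ab; lia.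
- by have := incr _ _ lt_ja; lia.
- by move: phi_j; rewrite -(val_inj E) phi_a /=; lia.
Qed.

(** The vector has weakly decreasing nonzero entries with zeros interspersed.
    If some nonzero entry follows a zero, one Demazure operator undoes the
    exchange of the two, on both sides; otherwise the nonzero entries come
    first, the vector is a partition, and both sides are a monomial. *)
Lemma demazure_flagged_jt d (lam phi : 'I_d -> nat) :
  (forall i j : 'I_d, (i < j)%N -> (phi i < phi j)%N) ->
  (forall i, 0 < phi i <= n)%N ->
  (forall i j : 'I_d, (i <= j)%N -> (lam j <= lam i)%N) ->
  (forall i, 0 < lam i)%N ->
  demazure (flag_mnm lam phi) = \det (flagged_jt X lam phi).
Proof.
move=> incr bnd decr pos; have [N] := ubnP (\sum_i phi i)%N.
elim: N => // N IH in phi incr bnd *; rewrite ltnS => leN.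
have inj_phi : injective phi.
  by move=> i j E; case: (ltngtP i j) => [/incr|/incr|/val_inj //]; rewrite E ltnn.
case: (boolP [exists i, (1 < phi i)%N && [forall j, phi j != (phi i).-1]]).
  case/existsP=> i0 /andP[gt1 /forallP no_pred].
  have := bnd i0 => bnd0.
  have lt_p : ((phi i0).-2 < n)%N by lia.
  have lt_q : ((phi i0).-1 < n)%N by lia.
  pose p := Ordinal lt_p; pose q := Ordinal lt_q.
  have pq : p.+1 = q :> nat by rewrite /=; lia.
  have phi0 : phi i0 = q.+1 by rewrite /=; lia.
  clearbody p q; clear lt_p lt_q.
  pose phi' (i : 'I_d) := if i == i0 then p.+1 else phi i.
  have phi'0 : phi' i0 = p.+1 by rewrite /phi' eqxx.
  have phi'E i : i != i0 -> phi' i = phi i by rewrite /phi' => /negPf ->.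
  have phi_ne (i : 'I_d) : phi i != p.+1 by have := no_pred i; rewrite phi0 pq.
  have incr' (i j : 'I_d) : (i < j)%N -> (phi' i < phi' j)%N.
    move=> lt_ij; have := incr _ _ lt_ij; have := phi_ne i; have := phi_ne j.
    move: lt_ij; rewrite /phi'; case: (eqVneq i i0) => [->|_];
      case: (eqVneq j i0) => [->|_] //; lia.
  have inj_phi' : injective phi'.
    by move=> i j E; case: (ltngtP i j) => [/incr'|/incr'|/val_inj //]; rewrite E ltnn.
  have phi'_ne i : phi' i != q.+1.
    rewrite /phi'; case: (eqVneq i i0) => [_|ne]; first by rewrite pq neq_ltn ltnSn.
    by rewrite -phi0 (inj_eq inj_phi).
  have mp : flag_mnm lam phi p = 0%N by apply: flag_mnm0.
  have mq : flag_mnm lam phi q = lam i0 by apply: flag_mnmE.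
  rewrite (demazure_step pq) ?mp ?mq //.
  have -> : mnm_swap p q (flag_mnm lam phi) = flag_mnm lam phi'.
    apply/mnmP=> l; rewrite mnm_swapE; case: tpermP => [->|->|].
    - by rewrite mq (@flag_mnmE _ _ _ i0).
    - by rewrite mp flag_mnm0.
    - move=> /eqP lp /eqP lq; rewrite !mnmE; apply: eq_bigl => i; rewrite /phi'.
      case: (eqVneq i i0) => [->|//]; rewrite phi0 !eqSS eq_sym [RHS]eq_sym.
      by rewrite !val_eqE (negPf lp) (negPf lq).
  rewrite IH //.
  - apply: (demazure_pi_flagged_jt lam pq phi'0 phi0) => i ne.
    by rewrite phi'E.
  - by move=> i; rewrite /phi'; case: eqP => // _; lia.
  - apply: leq_trans leN; rewrite (bigD1 i0) // [X in (_ < X)%N](bigD1 i0) //=.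
    rewrite -ltnS (eq_bigr phi) => [|i /phi'E //]; rewrite phi'0 /=; lia.
rewrite negb_exists => /forallP all_pred.
have phiE : forall i : 'I_d, phi i = i.+1.
  apply: flag_initial => // [i|i gt1]; first by case/andP: (bnd i).
  have := all_pred i; rewrite gt1 negb_forall => /existsP[j /negPn/eqP].
  by exists j.
have le_dn : (d <= n)%N.
  case: (d) phi phiE bnd {IH incr leN inj_phi all_pred decr pos lam} => //.
  move=> d' phi phiE bnd.
  by have := bnd ord_max; rewrite phiE => /andP[].
rewrite demazure_dominant => [|i j ij]; last first.
  have [lt_jd|ge_jd] := ltnP j d; last first.
    rewrite (@flag_mnm0 _ lam phi j) // => a; rewrite phiE eqSS.
    by have := ltn_ord a; lia.
  have lt_id : (i < d)%N by lia.
  rewrite (@flag_mnmE _ _ _ (Ordinal lt_jd)) ?phiE //.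
  by rewrite (@flag_mnmE _ _ _ (Ordinal lt_id)) ?phiE // decr //=; lia.
rewrite det_flagged_jt_dominant ?size_allvars // mpolyXE_id.
rewrite (eq_bigr (fun i : 'I_d => 'X_(widen_ord le_dn i) ^+ lam i)) => [|i _];
  last first.
  by rewrite -(nth_allvars (widen_ord le_dn i)).
rewrite (bigID (fun l : 'I_n => (l < d)%N)) /= [X in _ * X]big1 ?mulr1 => [|l];
  last first.
  rewrite -leqNgt => ge_l; rewrite flag_mnm0 // => a; rewrite phiE eqSS.
  by have := ltn_ord a; lia.
rewrite (big_ord_narrow le_dn); apply: eq_bigr => i _.
by rewrite (@flag_mnmE _ _ _ i) ?phiE.
Qed.

End DemazureDeterminant.

(** * Leading monomials of the determinants *)

Section LeadingMonomials.
Variable n : nat.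
Implicit Types (p q : {mpoly rat[n]}) (m u v : 'X_{1..n}).

Definition rev_vars := vars (map (@rev_ord n) (enum 'I_n)).

(** [mlead] compares total degrees first and then lexicographically, so for
    homogeneous polynomials it is the lexicographic leading monomial, and it
    also suits the inhomogeneous deformations considered later. *)
Definition monic_at u p := [/\ p \is (mdeg u).-homog, p@_u = 1 & mlead p = u].

Lemma mlead_eq u p : p@_u != 0 -> (forall m, (u < m)%O -> p@_m = 0) -> mlead p = u.
Proof.
move=> pu gt0; have p0 : p != 0 by apply: contraNneq pu => ->; rewrite mcoeff0.
apply/eqP; rewrite eq_le msupp_le_mlead ?mcoeff_msupp // andbT leNgt.
by apply/negP=> /gt0 E; have := mlead_supp p0; rewrite mcoeff_msupp E eqxx.
Qed.

Lemma monic_at_neq0 u p : monic_at u p -> p != 0.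
Proof.
by case=> _ pu _; apply/eqP=> p0; move/eqP: pu; rewrite p0 mcoeff0 eq_sym oner_eq0.
Qed.

Lemma monic_at1 : monic_at 0%MM 1.
Proof. by split; rewrite ?mlead1 ?mcoeff1 ?eqxx // mdeg0 dhomog1. Qed.

Lemma monic_atM u v p q :
  monic_at u p -> monic_at v q -> monic_at (u + v)%MM (p * q).
Proof.
move=> mp mq; have [p0 q0] := (monic_at_neq0 mp, monic_at_neq0 mq).
case: mp mq => hp cp lp [hq cq lq]; split.
- by rewrite mdegD dhomogM.
- by rewrite -lp -lq mleadcM lp lq cp cq mulr1.
- by rewrite mleadM // lp lq.
Qed.

Lemma monic_at_prod (I : Type) (r : seq I) (U : I -> 'X_{1..n}) F :
  (forall i, monic_at (U i) (F i)) ->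
  monic_at (\sum_(i <- r) U i)%MM (\prod_(i <- r) F i).
Proof.
move=> mF; elim: r => [|i r IH]; first by rewrite !big_nil; apply: monic_at1.
by rewrite !big_cons; apply: monic_atM.
Qed.

Lemma monic_at_hsym d (i : 'I_n) :
  monic_at (U_(i) *+ d)%MM (hsym d [set j : 'I_n | (i <= j)%N]).
Proof.
have cE : (hsym d [set j : 'I_n | (i <= j)%N])@_(U_(i) *+ d)%MM = 1.
  rewrite mcoeff_hsym mdegMn mdeg1 mul1n eqxx.
  rewrite (_ : [forall j, _] = true) //; apply/forallP=> j.
  rewrite inE mulmnE mnm1E; case: (eqVneq i j) => [<-|_]; last by rewrite mul0n.
  by rewrite leqnn implybT.
split=> //.
  apply/dhomogP => m; rewrite mcoeff_msupp mcoeff_hsym mdegMn mdeg1 mul1n.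
  by rewrite pnatr_eq0 eqb0 negbK => /andP[/eqP].
apply: mlead_eq => [|m]; first by rewrite cE oner_neq0.
move=> lt_m; apply/eqP; rewrite mcoeff_hsym pnatr_eq0 eqb0; apply/andP=> -[/eqP deg_m].
move/forallP=> supp_m; have eqd : mdeg (U_(i) *+ d)%MM = mdeg m.
  by rewrite mdegMn mdeg1 mul1n.
have [j eq_m] := ltmcP eqd lt_m; rewrite mulmnE mnm1E.
have [ij|] := eqVneq i j; last first.
  rewrite mul0n => ne_ij mj; have := supp_m j.
  rewrite -lt0n mj inE /= leq_eqVlt val_eqE (negPf ne_ij) /= => lt_ij.
  have := eq_m i lt_ij; rewrite mulmnE mnm1E eqxx mul1n => mi.
  by move: deg_m; rewrite mdegE (bigD1 i) // (bigD1 j) 1?eq_sym //= -mi; lia.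
rewrite mul1n -ij => lt_d; move: deg_m; rewrite mdegE (bigD1 i) //=; lia.
Qed.

Lemma csym_rev_vars d (i : 'I_n) :
  csym (take (n - i) rev_vars) d = hsym d [set j : 'I_n | (i <= j)%N].
Proof.
rewrite -map_take -map_take -hsym_csym; last first.
  by rewrite map_inj_uniq ?take_uniq ?enum_uniq //; apply: rev_ord_inj.
congr hsym; apply/setP=> j; rewrite !inE -{1}(rev_ordK j) mem_map;
  last exact: rev_ord_inj.
by rewrite mem_take_enum /=; have := ltn_ord i; have := ltn_ord j; lia.
Qed.

(** With the variables in reverse order row i involves the variables from
    psi_i on, and its entries have powers of x_(psi_i) as leading monomials.
    The identity permutation contributes the stated monomial. For another
    permutation s, let i be the largest index that it moves: then s i < i,
    which lowers the exponent of x_(psi_i), and psi_i comes before every other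
    variable whose exponent changes. *)
Lemma monic_at_flagged_jt d (lam phi : 'I_d -> nat) (psi : 'I_d -> 'I_n) :
  (forall i j : 'I_d, (i < j)%N -> (psi j < psi i)%N) ->
  (forall i, phi i = n - psi i)%N ->
  monic_at (\sum_i U_(psi i) *+ lam i)%MM
    (\det (flagged_jt rev_vars lam phi)).
Proof.
move=> decr phiE; set u := (\sum_i _)%MM; set M := flagged_jt _ _ _.
have inj_psi : injective psi.
  by move=> i j E; case: (ltngtP i j) => [/decr|/decr|/val_inj //]; rewrite E ltnn.
have ME i j : M i j = if (i <= lam i + j)%N
    then hsym (lam i + j - i) [set l : 'I_n | (psi i <= l)%N] else 0.
  by rewrite mxE /csym_shift phiE csym_rev_vars.
have monic_term (s : {perm 'I_d}) : (forall i : 'I_d, i <= lam i + s i)%N ->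
    monic_at (\sum_i U_(psi i) *+ (lam i + s i - i))%MM (\prod_i M i (s i)).
  by move=> le_s; apply: monic_at_prod => i; rewrite ME le_s; apply: monic_at_hsym.
have sumE (e : 'I_d -> nat) l : (\sum_i U_(psi i) *+ e i)%MM (psi l) = e l.
  rewrite mnm_sumE (bigD1 l) //= mulmnE mnm1E eqxx mul1n big1 ?addn0 // => i ne.
  by rewrite mulmnE mnm1E (inj_eq inj_psi) (negPf ne) mul0n.
have degE (e : 'I_d -> nat) : mdeg (\sum_i U_(psi i) *+ e i)%MM = (\sum_i e i)%N.
  by rewrite mdeg_sum; apply: eq_bigr => i _; rewrite mdegMn mdeg1 mul1n.
have lower (s : {perm 'I_d}) : s != 1%g ->
    \prod_i M i (s i) \is (mdeg u).-homog /\
    forall m, (u <= m)%O -> (\prod_i M i (s i))@_m = 0.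
  move=> s1; case: (boolP [forall i : 'I_d, (i <= lam i + s i)%N]) => [/forallP le_s|];
    last first.
    rewrite negb_forall => /existsP[i lt_i].
    rewrite (bigD1 i) //= ME (negPf lt_i) mul0r dhomog0.
    by split=> // m _; rewrite mcoeff0.
  have [hom_s c_s lead_s] := monic_term s le_s.
  have deg_s : mdeg (\sum_i U_(psi i) *+ (lam i + s i - i))%MM = mdeg u.
    rewrite !degE; apply/eqP; rewrite -(eqn_add2r (\sum_(i < d) i)) -!big_split /=.
    rewrite (eq_bigr (fun i => lam i + s i)%N) => [|i _]; last by rewrite subnK.
    by rewrite !big_split /= (reindex_perm s) /= [X in _ == (_ + X)%N](reindex_perm s).
  split=> [|m le_m]; first by rewrite -deg_s.
  apply: mcoeff_gt_mlead; rewrite lead_s; apply: lt_le_trans le_m; apply/ltmcP => //.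
  have /existsP[i0 ne0] : [exists i, s i != i].
    rewrite -negb_forall; apply: contra s1 => /forallP e.
    by apply/eqP/permP=> i; rewrite perm1; apply/eqP.
  case: (@arg_maxnP _ i0 (fun i => s i != i) (fun i => i : nat) ne0) => i ne_i maxi.
  have fix_gt (j : 'I_d) : (i < j)%N -> s j = j.
    by move=> lt_ij; apply/eqP; apply: contraLR lt_ij => /maxi; rewrite -leqNgt.
  have lt_si : (s i < i)%N.
    have [//|lt_i|/val_inj E] := ltngtP (s i) i; last by rewrite E eqxx in ne_i.
    by have /perm_inj E := fix_gt _ lt_i; rewrite E eqxx in ne_i.
  exists (psi i); last by rewrite !sumE; have := le_s i; lia.
  move=> l lt_l; have [/existsP[j /eqP E]|no] := boolP [exists j, psi j == l].
    rewrite -E !sumE fix_gt ?addnK //; rewrite -E in lt_l.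
    by have [//|/decr|/val_inj E'] := ltngtP i j; [lia|rewrite E' ltnn in lt_l].
  rewrite negb_exists in no; move/forallP: no => no.
  by rewrite !mnm_sumE !big1 // => j _; rewrite mulmnE mnm1E (negPf (no j)).
have id_term : \prod_i M i ((1%g : {perm 'I_d}) i) = \prod_i M i i.
  by apply: eq_bigr => i _; rewrite perm1.
have [h1 c1 l1] : monic_at u (\prod_i M i i).
  rewrite -id_term (_ : u = (\sum_i U_(psi i) *+ (lam i + (1%g : {perm 'I_d}) i - i))%MM).
    by apply: monic_term => i; rewrite perm1 leq_addl.
  by apply: eq_bigr => i _; rewrite perm1 addnK.
have detE : \det M = \prod_i M i i +
    \sum_(s : {perm 'I_d} | s != 1%g) (-1) ^+ s * \prod_i M i (s i).
  by rewrite /determinant (bigD1 1%g) //= odd_perm1 mul1r id_term.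
have signE (s : {perm 'I_d}) q : (-1) ^+ s * q = ((-1) ^+ s : rat) *: q.
  by case: (odd_perm s); rewrite ?expr1 ?expr0 ?scaleN1r ?scale1r ?mulN1r ?mul1r.
have rest_coeff m : (u <= m)%O ->
    (\sum_(s : {perm 'I_d} | s != 1%g) (-1) ^+ s * \prod_i M i (s i))@_m = 0.
  move=> le_m; rewrite raddf_sum big1 // => s s1 /=.
  by rewrite signE mcoeffZ (lower s s1).2 ?mulr0.
have cu : (\det M)@_u = 1 by rewrite detE mcoeffD c1 rest_coeff ?addr0.
split=> //.
  rewrite detE rpredD // rpred_sum // => s s1.
  by rewrite signE dhomogZ //; case: (lower s s1).
apply: mlead_eq => [|m lt_m]; first by rewrite cu oner_neq0.
rewrite detE mcoeffD rest_coeff ?ltW // addr0; apply: mcoeff_gt_mlead.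
by rewrite l1.
Qed.
End LeadingMonomials.

(** * Ideals spanned by a predicate *)

Section IdealSpan.
Variables (R : comNzRingType) (S : R -> Prop).

Lemma ideal_span_gen g : S g -> ideal_span S g.
Proof.
move=> Sg; exists [:: (1, g)]; last by rewrite big_seq1 mul1r.
by move=> c; rewrite inE => /eqP ->.
Qed.

Lemma ideal_span0 : ideal_span S 0.
Proof. by exists [::]; rewrite ?big_nil. Qed.

Lemma ideal_spanD p q : ideal_span S p -> ideal_span S q -> ideal_span S (p + q).
Proof.
move=> [s Ss ->] [t St ->]; exists (s ++ t); last by rewrite big_cat.
by move=> c; rewrite mem_cat => /orP[/Ss|/St].
Qed.

Lemma ideal_spanM p q : ideal_span S p -> ideal_span S (q * p).
Proof.
move=> [s Ss ->]; exists [seq (q * c.1, c.2) | c <- s].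
  by move=> _ /mapP[c /Ss Sc ->].
by rewrite big_map big_distrr /=; apply: eq_bigr => c _; rewrite mulrA.
Qed.

Lemma ideal_span_ind (P : R -> Prop) :
  P 0 -> (forall p q, P p -> P q -> P (p + q)) -> (forall p g, S g -> P (p * g)) ->
  forall p, ideal_span S p -> P p.
Proof.
move=> P0 PD PM p [s Ss ->]; rewrite big_seq; elim/big_ind: _ => // c cs.
exact/PM/Ss.
Qed.
End IdealSpan.

(** * Skip vectors *)

Lemma incr_ord_gap d (f : 'I_d -> nat) :
  (forall i j : 'I_d, (i < j)%N -> (f i < f j)%N) ->
  forall i j : 'I_d, (i <= j)%N -> (f i + (j - i) <= f j)%N.
Proof.
move=> incr i j; move: {2}(j - i)%N (erefl (j - i)%N) => g.
elim: g j => [|g IH] j gE le_ij.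
  by rewrite (_ : i = j) ?subnn ?addn0 //; apply/ord_inj; lia.
have lt_j' : (j.-1 < d)%N by apply: leq_ltn_trans (leq_pred _) (ltn_ord j).
have lt_f : (f (Ordinal lt_j') < f j)%N by apply: incr => /=; lia.
by have /= := IH (Ordinal lt_j') ltac:(move=> /=; lia) ltac:(move=> /=; lia); lia.
Qed.

Lemma incr_ord_ge d (f : 'I_d -> nat) :
  (forall i j : 'I_d, (i < j)%N -> (f i < f j)%N) -> forall j : 'I_d, (j <= f j)%N.
Proof.
move=> incr j; have lt0 : (0 < d)%N by apply: leq_ltn_trans (ltn_ord j).
by have := @incr_ord_gap _ _ incr (Ordinal lt0) j (leq0n _); rewrite /=; lia.
Qed.

Section SkipVector.
Variables (n d : nat) (A : {set 'I_n}) (cardA : #|A| = d).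

(** Sets of ordinals are enumerated in increasing order. *)
Definition nth_elt (j : 'I_d) : 'I_n := enum_val (cast_ord (esym cardA) j).

Lemma nth_elt_in j : nth_elt j \in A.
Proof. exact: enum_valP. Qed.

Lemma nth_elt_inj : injective nth_elt.
Proof. by move=> i j /enum_val_inj/cast_ord_inj. Qed.

Lemma nth_eltP l : l \in A -> exists j, nth_elt j = l.
Proof.
move=> lA; exists (cast_ord cardA (enum_rank_in lA l)).
by rewrite /nth_elt cast_ordK enum_rankK_in.
Qed.

Lemma nth_elt_lt (i j : 'I_d) : (i < j)%N -> (nth_elt i < nth_elt j)%N.
Proof.
move=> lt_ij; have x0 : 'I_n := nth_elt i.
rewrite /nth_elt !(enum_val_nth x0) -!(nth_map x0 0%N val) -?cardE //.
have srt : sorted ltn (map val (enum A)).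
  have : sorted ltn (map val (enum 'I_n)) by rewrite val_enum_ord iota_ltn_sorted.
  rewrite !sorted_map /enum_mem; apply: sorted_filter => x y z; exact: ltn_trans.
by apply: (sorted_ltn_nth ltn_trans 0%N srt); rewrite ?inE ?size_map -?cardE ?cardA.
Qed.

Lemma card_le_nth_elt (j : 'I_d) : #|[set s in A | (s <= nth_elt j)%N]| = j.+1.
Proof.
have -> : [set s in A | (s <= nth_elt j)%N] =
    nth_elt @: [set i : 'I_d | (i < j.+1)%N].
  apply/setP=> s; rewrite inE; apply/andP/imsetP => [[/nth_eltP[i <-] le_i]|[i]].
    exists i => //; rewrite inE ltnS leqNgt; apply/negP=> /nth_elt_lt.
    by rewrite ltnNge le_i.
  rewrite inE ltnS leq_eqVlt => /orP[/eqP/val_inj ->|/nth_elt_lt/ltnW lt_i] ->.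
    by rewrite leqnn nth_elt_in.
  by rewrite nth_elt_in.
rewrite card_imset; last exact: nth_elt_inj.
rewrite -sum1_card; under eq_bigl do rewrite inE.
by rewrite (big_ord_narrow (ltn_ord j)) sum1_card card_ord.
Qed.

(** In the reversed vector the largest element of A comes first: [skip_pos i]
    is the i-th element of A from the top, [skip_part i] the entry of the skip
    vector there, and [skip_flag i] its place, counted from 1, in the reversed
    vector. *)
Definition skip_pos (i : 'I_d) : 'I_n := nth_elt (rev_ord i).
Definition skip_part (i : 'I_d) : nat := ((skip_pos i).+1 - (d - i) + 1)%N.
Definition skip_flag (i : 'I_d) : nat := (n - skip_pos i)%N.

Lemma skip_pos_decr (i j : 'I_d) : (i < j)%N -> (skip_pos j < skip_pos i)%N.
Proof. by move=> lt_ij; apply: nth_elt_lt => /=; have := ltn_ord j; lia. Qed.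

Lemma skip_pos_inj : injective skip_pos.
Proof. by move=> i j /nth_elt_inj/rev_ord_inj. Qed.

Lemma skip_vector_pos i : skip_vector A (skip_pos i) = skip_part i.
Proof.
rewrite mnmE nth_elt_in card_le_nth_elt /= /skip_part; congr (_ - _ + 1)%N.
by have := ltn_ord i; lia.
Qed.

Lemma skip_posP l : l \in A -> exists i, skip_pos i = l.
Proof. by move=> /nth_eltP[j <-]; exists (rev_ord j); rewrite /skip_pos rev_ordK. Qed.

Lemma skip_vectorE : skip_vector A = (\sum_i U_(skip_pos i) *+ skip_part i)%MM.
Proof.
apply/mnmP=> l; rewrite mnm_sumE; have [/skip_posP[i <-]|lA] := boolP (l \in A).
  rewrite skip_vector_pos (bigD1 i) //= mulmnE mnm1E eqxx mul1n big1 ?addn0 // => j ne.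
  by rewrite mulmnE mnm1E (inj_eq skip_pos_inj) (negPf ne).
rewrite mnmE (negPf lA) big1 // => j _; rewrite mulmnE mnm1E.
by case: eqP => // E; rewrite -E nth_elt_in in lA.
Qed.

Lemma skip_flag_eq i (l : 'I_n) : (skip_flag i == l.+1) = (skip_pos i == rev_ord l).
Proof.
rewrite /skip_flag -val_eqE /=; have := ltn_ord l; have := ltn_ord (skip_pos i); lia.
Qed.

Lemma mnm_rev_skip : mnm_rev (skip_vector A) = flag_mnm n skip_part skip_flag.
Proof.
apply/mnmP=> l; rewrite [LHS]mnmE [RHS]mnmE skip_vectorE mnm_sumE.
rewrite [RHS]big_mkcond; apply: eq_bigr => i _.
by rewrite skip_flag_eq mulmnE mnm1E; case: eqP; rewrite ?mul1n ?mul0n.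
Qed.

(** The nonzero entries of the skip vector increase weakly along A, as each is
    one more than the number of smaller nonelements of A; so the reversed
    vector satisfies the hypotheses of [demazure_flagged_jt]. *)
Lemma mpoly_rev_demazure :
  mpoly_rev (demazure (mnm_rev (skip_vector A))) =
  \det (flagged_jt (rev_vars n) skip_part skip_flag).
Proof.
rewrite mnm_rev_skip demazure_flagged_jt.
- rewrite /mpoly_rev.
  rewrite -[LHS]/((comp_mpoly [tuple 'X_(rev_ord i) | i < n] : {rmorphism _ -> _}) _).
  rewrite -det_map_mx map_flagged_jt; congr (\det (flagged_jt _ _ _)).
  rewrite /rev_vars /vars -!map_comp; apply: eq_map => i /=.
  by rewrite comp_mpolyXU -tnth_nth tnth_mktuple.
- move=> i j /skip_pos_decr; rewrite /skip_flag.
  by have := ltn_ord (skip_pos i); lia.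
- by move=> i; rewrite /skip_flag; have := ltn_ord (skip_pos i); lia.
- move=> i j le_ij; rewrite /skip_part /skip_pos.
  have := @incr_ord_gap _ _ nth_elt_lt (rev_ord j) (rev_ord i); rewrite /=.
  have := incr_ord_ge nth_elt_lt (rev_ord j); have := ltn_ord i; have := ltn_ord j.
  by move=> ? ? /= ? H; have := H ltac:(lia); lia.
- by move=> i; rewrite /skip_part addn1.
Qed.

Lemma monic_at_kappa :
  monic_at (skip_vector A) (mpoly_rev (demazure (mnm_rev (skip_vector A)))).
Proof.
rewrite mpoly_rev_demazure skip_vectorE; apply: monic_at_flagged_jt => //.
exact: skip_pos_decr.
Qed.

(** Each nonzero entry of the reversed skip vector is one more than the number
    of zeros after it, which is exactly the degree bound of
    [det_flagged_jt_ideal]. *)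
Lemma kappa_in_ideal k r : (r <= n)%N -> d = (n - r + 1)%N ->
  ideal_I n k r (mpoly_rev (demazure (mnm_rev (skip_vector A)))).
Proof.
move=> le_rn dE; rewrite mpoly_rev_demazure.
have size_t : size (rev_vars n) = n.
  by rewrite /rev_vars /vars 2!size_map size_enum_ord.
apply: det_flagged_jt_ideal.
- by move=> x y; apply: ideal_spanM.
- by move=> x y; apply: ideal_spanD.
- exact: ideal_span0.
- move=> m ge_m; have -> : epoly (rev_vars n) = epoly (vars (enum 'I_n)).
    apply/perm_epoly/perm_map/uniq_perm; rewrite ?enum_uniq //.
      by rewrite map_inj_uniq ?enum_uniq //; apply: rev_ord_inj.
    by move=> i; rewrite -(rev_ordK i) mem_map ?mem_enum //; apply: rev_ord_inj.
  rewrite epoly_vars; apply: ideal_spanM.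
  have [gt_m|le_m] := ltnP n m; first by rewrite mesym_geqnE //; apply: ideal_span0.
  by apply: ideal_span_gen; right; exists m => //; rewrite le_m andbT -dE.
- by rewrite dE addn1.
- move=> i; rewrite size_t /skip_part /skip_flag /skip_pos.
  have := incr_ord_ge nth_elt_lt (rev_ord i); have := ltn_ord (nth_elt (rev_ord i)).
  by have := ltn_ord i; rewrite /=; lia.
- by move=> i; rewrite size_t leq_subr.
- by move=> i; rewrite /skip_part addn1.
Qed.

End SkipVector.

(** * Standard monomials and the lex game *)

(** Greedy choice of a set S whose skip vector is below the exponents [s]: [z]
    counts the positions skipped so far, and a position enters S when its
    exponent exceeds [z], which is the entry of the skip vector there minus 1.
    A standard monomial skips at least [r] positions in the end. The number N
    - size s' - 1 bounds the exponents of the monomials that are not multiples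
    of a power x_i^(k+i). *)
Fixpoint standard (r N z : nat) (s : seq nat) : bool :=
  if s is a :: s' then
    if (a <= z)%N then standard r N z.+1 s'
    else (a < N - size s')%N && standard r N z s'
  else (r <= z)%N.

Lemma leq_count_in (T : eqType) (P Q : pred T) s :
  {in s, forall b, P b -> Q b} -> (count P s <= count Q s)%N.
Proof.
elim: s => //= b s IH PQ; apply: leq_add.
  by move: (PQ b (mem_head b s)); case: (P b) => // /(_ isT) ->.
by apply: IH => a a_s; apply: PQ; rewrite inE a_s orbT.
Qed.

Section LexGame.
Variables (F : fieldType) (Om : seq F) (be : pred F).
Hypothesis uOm : uniq Om.
Local Notation r := (count be Om).
Local Notation N := (size Om).

Fixpoint seqmon (s : seq nat) (x : seq F) : F :=
  if s is a :: s' then head 0 x ^+ a * seqmon s' (behead x) else 1.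

(** After [z] skipped positions, up to [z] of the marked points may be
    missing. *)
Definition locus (z l : nat) (x : seq F) : bool :=
  [&& size x == l, uniq x, all (mem Om) x & (r - z <= count be x)%N].

Lemma count_outside (P : pred F) x :
  (count P Om - count P x <= count (fun b => P b && (b \notin x)) Om)%N.
Proof.
rewrite leq_subLR -size_filter -(count_predC (mem x)) !count_filter.
have -> : count (predI (predC (mem x)) P) Om = count (fun b => P b && (b \notin x)) Om.
  by apply: eq_count => b /=; rewrite andbC.
rewrite leq_add2r -!size_filter; apply: uniq_leq_size; first exact: filter_uniq.
by move=> b; rewrite !mem_filter /= => /andP[/andP[-> ->]].
Qed.

(** The points of the locus above the tail [x]. If [x] already contains enough
    marked points, any of the [N - l] points outside [x] can be put in front.
    Otherwise it lacks exactly one, and each of the [z.+1] marked points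
    outside [x] supplies it. *)
Lemma size_fibre z l J x : (z + l.+1 <= N)%N ->
  ((J <= z) || (J < N - l))%N ->
  locus (if (J <= z)%N then z.+1 else z) l x ->
  (J < size [seq b <- Om | locus z l.+1 (b :: x)])%N.
Proof.
move=> le_zl J_ok /and4P[/eqP sz_x ux x_Om cnt_x]; rewrite size_filter.
have [enough|few] := leqP (r - z) (count be x).
  apply: leq_trans (_ : N - size x <= _)%N; first by move: J_ok; lia.
  rewrite -(count_predT Om) -(count_predT x); apply: leq_trans (count_outside _ _) _.
  apply: leq_count_in => b b_Om /= b_x.
  by rewrite /locus /= sz_x eqxx b_x ux b_Om x_Om /=; lia.
have [le_J|gt_J] := leqP J z; last by move: cnt_x; rewrite ifN -?ltnNge //; lia.
apply: leq_trans (_ : r - count be x <= _)%N; first by move: cnt_x; rewrite le_J; lia.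
apply: leq_trans (count_outside _ _) _; apply: leq_count_in => b b_Om /= /andP[be_b b_x].
rewrite /locus /= sz_x eqxx b_x ux b_Om x_Om be_b /=.
by move: cnt_x; rewrite le_J; lia.
Qed.

(** A vanishing combination of standard monomials is a polynomial in the first
    coordinate with coefficients depending on the tail. Let J be its degree.
    Above each tail of the locus for the next step there are more than J
    points, so that the leading coefficient vanishes at all these tails; it is
    itself a combination of standard monomials of the smaller locus, and the
    induction hypothesis makes it zero. *)
Lemma standard_independent l z (L : seq (seq nat)) (c : seq nat -> F) :
  uniq L -> (forall s, s \in L -> size s = l /\ standard r N z s) ->
  (z + l <= N)%N ->
  (forall x, locus z l x -> \sum_(s <- L) c s * seqmon s x = 0) ->
  forall s, s \in L -> c s = 0.
Proof.
elim: l z L c => [|l IH] z L c uL stdL le_zl vanish s sL.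
  have [/size0nil s0 le_rz] := stdL s sL; rewrite s0 /= in le_rz.
  have := vanish [::]; rewrite /locus /= (eqP (_ : r - z == 0)%N) // => /(_ isT).
  rewrite (bigD1_seq s) //= big_seq_cond big1 => [|t /andP[tL]].
    by rewrite s0 mulr1 addr0.
  by have [/size0nil ->] := stdL t tL; rewrite s0 eqxx.
apply/eqP; apply: contraT => cs0.
(* J is the largest exponent of the first coordinate that occurs. *)
pose L' := [seq t <- L | c t != 0]; pose hd (t : seq nat) := head 0%N t.
have sL' : s \in L' by rewrite mem_filter cs0.
have stdL' t : t \in L' -> size t = l.+1 /\ standard r N z t.
  by rewrite mem_filter => /andP[_ /stdL].
have exJ : exists j, has (fun t => hd t == j) L'.
  by exists (hd s); apply/hasP; exists s.
have bndJ j : has (fun t => hd t == j) L' -> (j <= \max_(t <- L') hd t)%N.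
  by case/hasP=> t tL' /eqP <-; apply: leq_bigmax_seq.
case: (ex_maxnP exJ bndJ) => J /hasP[t0 t0L' /eqP t0J] maxJ.
have le_J t : t \in L' -> (hd t <= J)%N.
  by move=> tL'; apply: maxJ; apply/hasP; exists t.
pose z' := if (J <= z)%N then z.+1 else z.
have std_tail t : t \in L' -> hd t = J ->
    size (behead t) = l /\ ((J <= z) || (J < N - l))%N && standard r N z' (behead t).
  move=> tL'; have [] := stdL' t tL'; case: t {tL'} => //= a t [sz_t].
  rewrite /hd /= => std_t aJ; rewrite {a}aJ in std_t; split=> //; rewrite /z'.
  by move: std_t; case: ifP => //= _; rewrite sz_t.
have [sz_t0 /andP[J_ok _]] := std_tail t0 t0L' t0J.
pose LJ := [seq behead t | t <- L' & hd t == J].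
have consK t : t \in L' -> hd t = J -> t = J :: behead t.
  by move=> /stdL'[]; case: t => //= a t _ _; rewrite /hd /= => ->.
have c0 : forall t, t \in LJ -> c (J :: t) = 0.
  apply: (IH z' LJ).
  - rewrite map_inj_in_uniq ?filter_uniq // => t t'.
    rewrite !(mem_filter (fun t => hd t == J)).
    move=> /andP[/eqP tJ tL'] /andP[/eqP t'J t'L'] E.
    by rewrite (consK t) // (consK t') // E.
  - move=> _ /mapP[t + ->]; rewrite mem_filter => /andP[/eqP tJ tL'].
    by have [-> /andP[]] := std_tail t tL' tJ.
  - by rewrite /z'; case: ifP; lia.
  move=> x x_loc; rewrite big_map big_filter.
  pose p : {poly F} := \sum_(t <- L') (c t * seqmon (behead t) x) *: 'X^(hd t).
  have : p = 0.
    apply/eqP; apply: contraT => p0.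
    have := max_poly_roots p0 (rs := [seq b <- Om | locus z l.+1 (b :: x)]).
    rewrite filter_uniq // => /(_ _ isT) H.
    have : (size p <= J.+1)%N.
      apply/leq_sizeP => j lt_j; rewrite coef_sum big_seq big1 // => t tL'.
      rewrite coefZ coefXn; case: eqP => [E|]; last by rewrite mulr0.
      by have := le_J t tL'; lia.
    have := size_fibre le_zl J_ok x_loc => lt_J le_p.
    have : (size [seq b <- Om | locus z l.+1 (b :: x)] < size p)%N.
      apply: H; apply/allP => b; rewrite mem_filter => /andP[b_loc _].
      rewrite rootE horner_sum; apply/eqP; rewrite -[RHS](vanish _ b_loc).
      rewrite big_filter big_mkcond; apply: eq_big_seq => t tL.
      have [sz_t _] := stdL t tL; case: eqP => [->|_] /=; first by rewrite mul0r.
      rewrite !hornerE; case: t sz_t {tL} => //= a t _; rewrite /hd /= mulrCA mulrA; ring.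
    by move/leq_trans/(_ le_p); rewrite ltnS leqNgt lt_J.
  move=> p0; rewrite -[RHS](coef0 F J) -p0 coef_sum.
  rewrite [LHS]big_mkcond; apply: eq_big_seq => t tL' /=; rewrite coefZ coefXn.
  rewrite eq_sym; case: eqP => [tJ|_] /=; last by rewrite mulr0.
  by rewrite mulr1 -consK.
have t0LJ : behead t0 \in LJ by apply: map_f; rewrite mem_filter t0J eqxx.
have ct0 : c t0 = 0 by rewrite (consK t0 t0L' t0J) c0.
by move: t0L'; rewrite mem_filter ct0 eqxx.
Qed.
End LexGame.

(** * Deformation of the ideal to a finite set of points *)

Lemma seqmonE (F : fieldType) (s : seq nat) (x : seq F) :
  seqmon s x = \prod_(i < size s) nth 0 x i ^+ nth 0%N s i.
Proof.
elim: s x => [|a s IH] x /=; first by rewrite big_ord0.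
rewrite big_ord_recl /= nth0 IH; congr (_ * _); apply: eq_bigr => i _ /=.
by rewrite nth_behead.
Qed.

Lemma mcoeffMX_le n (p : {mpoly rat[n]}) (u m : 'X_{1..n}) :
  (p * 'X_[u])@_m = if (u <= m)%MM then p@_(m - u) else 0.
Proof.
case: ifP => [/submK <-|le_um]; first by rewrite addmC mcoeffMX addmC addmK.
apply/eqP; rewrite mcoeff_eq0 (perm_mem (msuppMX _ _)); apply/mapP=> -[m' _ mE].
by move: le_um; rewrite mE lem_addr.
Qed.

Section Deformation.
Variables (n k r : nat).
Hypothesis le_rn : (r <= n)%N.

(** Any k + n distinct numbers, r of them marked, would do. *)
Definition points : seq rat := [seq i%:R | i <- iota 0 (k + n)].
Definition marked : seq rat := [seq i%:R | i <- iota 0 r].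
Local Notation X := (vars (enum 'I_n)).

Definition vanishing (f : {mpoly rat[n]}) : Prop :=
  forall x, locus points (mem marked) 0 n x -> f.@[fun i => nth 0 x i] = 0.

Lemma uniq_points : uniq points.
Proof. by rewrite map_inj_uniq ?iota_uniq // => i j /eqP; rewrite eqr_nat => /eqP. Qed.

Lemma uniq_marked : uniq marked.
Proof. by rewrite map_inj_uniq ?iota_uniq // => i j /eqP; rewrite eqr_nat => /eqP. Qed.

Lemma size_points : size points = (k + n)%N.
Proof. by rewrite size_map size_iota. Qed.

Lemma size_marked : size marked = r.
Proof. by rewrite size_map size_iota. Qed.

Lemma count_marked : count (mem marked) points = r.
Proof.
have -> : points = marked ++ [seq i%:R | i <- iota r (k + n - r)].
  by rewrite -map_cat -iotaD; congr map; congr iota; lia.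
rewrite count_cat (eq_in_count (a2 := predT)) => [|b b_m]; last exact: b_m.
rewrite count_predT size_marked.
rewrite (eq_in_count (a2 := pred0)) ?count_pred0 ?addn0 // => b /mapP[i + ->].
rewrite mem_iota => /andP[ge_r _]; apply/negbTE/mapP=> -[j].
rewrite mem_iota => /andP[_ lt_j] /eqP; rewrite eqr_nat => /eqP E; lia.
Qed.

Lemma vanishing0 : vanishing 0.
Proof. by move=> x _; rewrite meval0. Qed.

Lemma vanishingD f g : vanishing f -> vanishing g -> vanishing (f + g).
Proof. by move=> Vf Vg x x_loc; rewrite mevalD Vf // Vg // addr0. Qed.

Lemma vanishingM f g : vanishing g -> vanishing (f * g).
Proof. by move=> Vg x x_loc; rewrite mevalM Vg // mulr0. Qed.

Lemma vanishingB f g : vanishing f -> vanishing g -> vanishing (f - g).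
Proof. by move=> Vf Vg; rewrite -mulN1r; apply/vanishingD/vanishingM. Qed.

Lemma meval_vars (x : seq rat) : size x = n ->
  map (meval (fun i : 'I_n => nth 0 x i)) X = x.
Proof.
move=> sz_x; apply: (@eq_from_nth _ 0); first by rewrite 2!size_map size_enum_ord.
move=> i; rewrite 2!size_map size_enum_ord => lt_i.
rewrite -map_comp (nth_map (Ordinal lt_i)) ?size_enum_ord //= mevalXU.
by rewrite nth_enum_ord.
Qed.

(** At a point of the locus the coordinates are n of the k + n values, so that
    [econv points x] is a coefficient of a product of k linear factors and
    vanishes in degrees above k. This polynomial expresses that; its part of
    top degree is h_m. *)
Definition csym_deform m : {mpoly rat[n]} :=
  \sum_(i < m.+1) (epoly points)`_i *: csym X (m - i).

(** Likewise for (-1)^m e_m: the coordinates contain all r marked values, so that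
    [econv x marked] is a coefficient of a product of n - r linear factors. *)
Definition epoly_deform m : {mpoly rat[n]} :=
  \sum_(i < m.+1) csym marked (m - i) *: (epoly X)`_i.

Lemma vanishing_csym_deform m : (k < m)%N -> vanishing (csym_deform m).
Proof.
move=> lt_km x /and4P[/eqP sz_x ux x_Om _].
have -> : (csym_deform m).@[fun i => nth 0 x i] = econv points x m.
  rewrite raddf_sum; apply: eq_bigr => i _ /=.
  by rewrite mevalZ -{2}(meval_vars sz_x) -rmorph_csym.
have E : perm_eq points (x ++ [seq b <- points | b \notin x]).
  apply: uniq_perm; first exact: uniq_points.
    rewrite cat_uniq ux filter_uniq ?uniq_points ?andbT //=.
    by apply/hasPn=> b; rewrite mem_filter => /andP[].
  move=> b; rewrite mem_cat mem_filter; case: (boolP (b \in x)) => //= b_x.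
  exact: (allP x_Om b b_x).
have := perm_size E; rewrite size_cat size_points sz_x => sz_y.
rewrite (perm_econv _ _ E) -[X in econv _ X _]cats0 econv_cancel econv_empty.
rewrite epoly_gt_size //; apply: leq_ltn_trans lt_km.
by rewrite -(leq_add2l n) -sz_y addnC.
Qed.

Lemma vanishing_epoly_deform m : (n - r < m)%N -> vanishing (epoly_deform m).
Proof.
move=> lt_m x /and4P[/eqP sz_x ux _]; rewrite count_marked subn0 => cnt_x.
have -> : (epoly_deform m).@[fun i => nth 0 x i] = econv x marked m.
  rewrite raddf_sum; apply: eq_bigr => i _ /=.
  by rewrite mevalZ -{2}(meval_vars sz_x) -rmorph_epoly mulrC.
have sub : [seq b <- x | b \in marked] =i marked.
  have [] // := @uniq_min_size _ [seq b <- x | b \in marked] marked.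
  - exact: filter_uniq.
  - by move=> b; rewrite mem_filter => /andP[].
  - by rewrite size_marked size_filter.
have E : perm_eq x (marked ++ [seq b <- x | b \notin marked]).
  apply: uniq_perm => //.
    rewrite cat_uniq uniq_marked filter_uniq ?andbT //=.
    by apply/hasPn=> b; rewrite mem_filter => /andP[].
  move=> b; rewrite mem_cat -sub !mem_filter.
  by case: (b \in marked) => //=; rewrite orbF.
have := perm_size E; rewrite size_cat size_marked sz_x => sz_y.
rewrite (perm_econv _ _ E) -[X in econv _ X _]cats0 econv_cancel econv_empty.
rewrite epoly_gt_size //; apply: leq_ltn_trans lt_m.
by rewrite -(leq_add2l r) -sz_y subnKC.
Qed.

Lemma mcoeff_csym_ne d (m : 'X_{1..n}) : mdeg m != d -> (csym X d)@_m = 0.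
Proof. by rewrite mcoeff_csym_vars ?enum_uniq // => /negPf ->. Qed.

Lemma mcoeff_epoly_ne d (m : 'X_{1..n}) : mdeg m != d -> ((epoly X)`_d)@_m = 0.
Proof.
rewrite epoly_vars.
have -> : (-1) ^+ d * mesym n rat d = ((-1) ^+ d : rat) *: mesym n rat d.
  rewrite -signr_odd -[in RHS]signr_odd; case: (odd d).
    by rewrite !expr1 mulN1r scaleN1r.
  by rewrite !expr0 mul1r scale1r.
move=> ne; rewrite mcoeffZ; have := dhomog_nemf_coeff (dhomog_mesym n rat d) ne.
by move=> ->; rewrite mulr0.
Qed.

Lemma mcoeff_csym_deform d (m : 'X_{1..n}) :
  (d <= mdeg m)%N -> (csym_deform d)@_m = (csym X d)@_m.
Proof.
move=> le_d; rewrite raddf_sum big_ord_recl /= mcoeffZ epoly_coef0 mul1r subn0.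
rewrite big1 ?addr0 // => i _; rewrite mcoeffZ mcoeff_csym_ne ?mulr0 //.
by rewrite /bump /=; have := ltn_ord i; lia.
Qed.

Lemma mcoeff_epoly_deform d (m : 'X_{1..n}) :
  (d <= mdeg m)%N -> (epoly_deform d)@_m = ((epoly X)`_d)@_m.
Proof.
move=> le_d; rewrite raddf_sum big_ord_recr /= mcoeffZ subnn csym0 mul1r.
rewrite big1 ?add0r // => i _; rewrite mcoeffZ mcoeff_epoly_ne ?mulr0 //.
by have := ltn_ord i; lia.
Qed.

(** Up to terms of lower degree, each homogeneous component of [f] is a
    polynomial that vanishes on the locus. *)
Definition deformable (f : {mpoly rat[n]}) : Prop := forall D, exists2 f',
  vanishing f' &
  forall m, (D <= mdeg m)%N -> f'@_m = if mdeg m == D then f@_m else 0.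

Lemma deformableD f g : deformable f -> deformable g -> deformable (f + g).
Proof.
move=> Df Dg D; have [f' Vf f'E] := Df D; have [g' Vg g'E] := Dg D.
exists (f' + g'); first exact: vanishingD.
by move=> m le_m; rewrite !mcoeffD f'E // g'E //; case: ifP; rewrite ?addr0.
Qed.

Lemma deformableZ c f : deformable f -> deformable (c *: f).
Proof.
move=> Df D; have [f' Vf f'E] := Df D.
exists (c *: f'); first by rewrite -mulr_algl; apply: vanishingM.
by move=> m le_m; rewrite !mcoeffZ f'E //; case: ifP; rewrite ?mulr0.
Qed.

Lemma deformable0 : deformable 0.
Proof.
by move=> D; exists 0; [apply: vanishing0|move=> m _; rewrite mcoeff0 if_same].
Qed.

(** It suffices to treat a monomial q. Then q g is homogeneous, and q g' is a
    deformation of it. *)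
Lemma deformableM d g g' :
  vanishing g' -> (forall m, (d <= mdeg m)%N -> g'@_m = g@_m) ->
  (forall m, mdeg m != d -> g@_m = 0) -> forall q, deformable (q * g).
Proof.
move=> Vg' g'E g_hom q; elim/mpolyind: q => [|c u q _ _ IH].
  by rewrite mul0r; apply: deformable0.
rewrite mulrDl -scalerAl; apply/(deformableD _ IH)/deformableZ => D.
have [->|neD] := eqVneq D (d + mdeg u)%N; last first.
  exists 0; [exact: vanishing0|move=> m _; rewrite mcoeff0; case: eqP => // mD].
  rewrite mulrC mcoeffMX_le; case: ifP => // /submK mE; rewrite g_hom //.
  by apply: contraNneq neD => <-; rewrite -mD -{1}mE mdegD.
exists ('X_[u] * g'); first exact: vanishingM.
move=> m le_m; rewrite ['X_[u] * g']mulrC ['X_[u] * g]mulrC !mcoeffMX_le.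
case: ifP => [/submK mE|]; last by case: ifP.
have degE : mdeg m = (mdeg (m - u) + mdeg u)%N by rewrite -{1}mE mdegD.
rewrite g'E; last by move: le_m; rewrite degE leq_add2r.
case: eqP => // ne; rewrite g_hom //; apply/eqP; lia.
Qed.

Lemma ideal_deformable f : ideal_I n k r f -> deformable f.
Proof.
apply: ideal_span_ind => [|p q|p g]; [exact: deformable0|exact: deformableD|].
case=> [[i /andP[i_gt0 _] ->]|[j /andP[ge_j _] ->]].
  have -> : hsym (k + i) [set: 'I_n] = csym X (k + i).
    rewrite -hsym_csym ?enum_uniq //; congr hsym; apply/setP=> l.
    by rewrite !inE mem_enum.
  apply: (@deformableM (k + i) _ (csym_deform (k + i))).
  - by apply: vanishing_csym_deform; lia.
  - exact: mcoeff_csym_deform.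
  - exact: mcoeff_csym_ne.
have -> : p * mesym n rat j = (p * (-1) ^+ j) * (epoly X)`_j.
  by rewrite epoly_vars -mulrA mulrA -mulrA signrMK.
apply: (@deformableM j _ (epoly_deform j)).
- by apply: vanishing_epoly_deform; lia.
- exact: mcoeff_epoly_deform.
- exact: mcoeff_epoly_ne.
Qed.

Lemma vanishing_standard_eq0 f : vanishing f ->
  (forall m, m \in msupp f -> standard r (k + n) 0 m) -> f = 0.
Proof.
move=> Vf stdf; pose L := [seq tval (multinom_val m) | m <- msupp f].
pose c (s : seq nat) := f@_[multinom nth 0%N s i | i < n].
have cE (m : 'X_{1..n}) : c m = f@_m.
  by congr (f@_ _); apply/mnmP=> i; rewrite mnmE -mnm_nth.
suff c0 : forall s, s \in L -> c s = 0.
  apply/mpolyP=> m; rewrite mcoeff0; apply/eqP; rewrite mcoeff_eq0; apply/negP=> fm.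
  have : c m = 0 by apply: c0; apply: map_f.
  by rewrite cE; apply/eqP; rewrite -mcoeff_msupp.
apply: (@standard_independent _ points (mem marked) uniq_points n 0 L c).
- by rewrite map_inj_uniq ?msupp_uniq // => m m' /val_inj/val_inj.
- move=> _ /mapP[m fm ->]; rewrite count_marked size_points size_tuple.
  by split=> //; apply: stdf.
- by rewrite size_points add0n leq_addl.
move=> x x_loc; rewrite big_map -[RHS](Vf x x_loc) mevalE.
apply: eq_bigr => m _; rewrite cE seqmonE size_tuple; congr (_ * _).
by apply: eq_bigr => i _; rewrite -mnm_nth.
Qed.

End Deformation.

(** * Lexicographic leading monomials of homogeneous polynomials *)

Section LexLead.
Variable n : nat.
Implicit Types (p : {mpoly rat[n]}) (u v : 'X_{1..n}).

Lemma lexlt_ltmc u v : mdeg u = mdeg v -> lexlt u v = (u < v)%O.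
Proof.
move=> deg_uv; apply/existsP/(ltmcP deg_uv).
  case=> i /andP[lt_i /forallP eq_i].
  by exists i => // j lt_j; apply/eqP/(implyP (eq_i j)).
case=> i eq_i lt_i; exists i; rewrite lt_i.
by apply/forallP=> j; apply/implyP=> /eq_i ->.
Qed.

Lemma lexlead_homog d p : p \is d.-homog -> p != 0 -> lexlead p = mlead p.
Proof.
move=> hp p0; have [lead_in lead_max] := lexleadP p0.
apply/eqP; rewrite eq_le msupp_le_mlead //= leNgt; apply/negP=> lt.
have min := mlead_supp p0; have degE := dhomog_mf hp.
have : lexlt (mlead p) (lexlead p) by apply: lead_max => //; rewrite gt_eqF.
by rewrite lexlt_ltmc ?degE // ltNge ltW.
Qed.

Lemma monic_at_lexlead u p : monic_at u p -> lexlead p = u /\ lexleadc p = 1.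
Proof.
move=> mp; case: (mp) => hp cp lp.
by rewrite /lexleadc (lexlead_homog hp (monic_at_neq0 mp)) lp.
Qed.

End LexLead.

(** * Divisors of nonstandard monomials *)

Section Greedy.
Variables (n k r : nat) (m : 'X_{1..n}).
Hypothesis le_rn : (r <= n)%N.
Local Notation d := (n - r + 1)%N.

(** The number of positions below [i] that the greedy choice behind [standard]
    leaves out. *)
Fixpoint skipped (i : nat) : nat :=
  if i is i'.+1 then
    if (nth 0 m i' <= skipped i')%N then (skipped i').+1 else skipped i'
  else 0.

Lemma skipped_le i : (skipped i <= i)%N.
Proof. by elim: i => //= i IH; case: ifP; lia. Qed.

(** If no x_j^(k+j) divides the monomial, the bounds on exponents in
    [standard] hold throughout, and only the final test on the number of
    skipped positions is left. *)
Lemma standard_drop i : (forall j : 'I_n, m j < k + j.+1)%N -> (i <= n)%N ->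
  standard r (k + n) (skipped i) (drop i m) = (r <= skipped n)%N.
Proof.
move=> bnd le_in; move: {2}(n - i)%N (erefl (n - i)%N) => g.
elim: g i le_in => [|g IH] i le_in gE.
  by rewrite (_ : i = n) ?drop_oversize ?size_tuple //; lia.
have lt_in : (i < n)%N by lia.
rewrite (drop_nth 0%N) ?size_tuple //= size_drop size_tuple.
have := bnd (Ordinal lt_in); rewrite (mnm_nth 0%N) /= => bnd_i.
have -> : (nth 0%N m i < k + n - (n - i.+1))%N by lia.
have IHi : standard r (k + n) (skipped i.+1) (drop i.+1 m) = (r <= skipped n)%N.
  by apply: IH; lia.
by move: IHi => /=; case: ifP.
Qed.

(** The first n - r + 1 positions chosen by the greedy procedure; [i - skipped
    i] is the number of positions chosen below [i]. *)
Definition greedy_set : {set 'I_n} :=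
  [set i : 'I_n | (skipped i < m i)%N && (i - skipped i < d)%N].

Lemma card_greedy_lt i : (i <= n)%N ->
  #|[set s in greedy_set | (s < i)%N]| = minn d (i - skipped i).
Proof.
elim: i => [|i IH] lt_in.
  rewrite sub0n minn0; apply/eqP; rewrite cards_eq0; apply/eqP/setP=> s.
  by rewrite !inE andbF.
rewrite (cardsD1 (Ordinal lt_in)) [in X in (X + _)%N]inE /= ltnSn andbT.
have -> : [set s in greedy_set | (s < i.+1)%N] :\ Ordinal lt_in =
    [set s in greedy_set | (s < i)%N].
  apply/setP=> s; rewrite !inE -val_eqE /= ltnS (ltn_neqAle s i).
  by case: (s == i :> nat); rewrite ?andbF.
rewrite (IH (ltnW lt_in)) inE /= (mnm_nth 0%N) /=.
have := skipped_le i; case: leqP => _ /=; lia.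
Qed.

Lemma nonstandard_divisible : ~~ standard r (k + n) 0 m ->
  (exists i : 'I_n, (U_(i) *+ (k + i.+1) <= m)%MM) \/
  (exists2 A : {set 'I_n}, #|A| = d & (skip_vector A <= m)%MM).
Proof.
move=> nstd; case: (boolP [exists i : 'I_n, k + i.+1 <= m i]%N) => [/existsP[i le_i]|].
  left; exists i; apply/mnm_lepP=> j; rewrite mulmnE mnm1E.
  by case: eqVneq => [<-|_]; rewrite ?mul1n ?mul0n.
rewrite negb_exists => /forallP bnd; right; exists greedy_set.
  have := card_greedy_lt (leqnn n).
  have -> : [set s in greedy_set | (s < n)%N] = greedy_set.
    by apply/setP=> s; rewrite inE ltn_ord andbT.
  move=> ->; move: nstd; have /= := @standard_drop 0 _ (leq0n n); rewrite drop0 => ->.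
    by have := skipped_le n; lia.
  by move=> j; rewrite ltnNge bnd.
apply/mnm_lepP=> i; rewrite mnmE; case: ifP => // iA.
have := card_greedy_lt (ltn_ord i).
have -> : [set s in greedy_set | (s < i.+1)%N] = [set s in greedy_set | (s <= i)%N].
  by apply/setP=> s; rewrite !inE ltnS.
move=> ->; move: iA; rewrite inE /= => /andP[lt_i lt_d].
have -> : (nth 0%N m i <= skipped i)%N = false by rewrite -mnm_nth leqNgt lt_i.
by have := skipped_le i; lia.
Qed.

End Greedy.

(** * Leading monomials of the ideal *)

Section NormalForm.
Variables (n k r : nat).
Hypothesis le_rn : (r <= n)%N.
Local Notation standard := (standard r (k + n) 0).
Local Notation vanishing := (@vanishing n k r).

Lemma groebner_hsym (i : 'I_n) :
  hsym (k + i.+1) [set j : 'I_n | (i <= j)%N] \in groebner_polys n k r.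
Proof. by rewrite mem_cat; apply/orP; left; apply: map_f; rewrite mem_enum. Qed.

Lemma groebner_kappa (A : {set 'I_n}) : #|A| = (n - r + 1)%N ->
  mpoly_rev (demazure (mnm_rev (skip_vector A))) \in groebner_polys n k r.
Proof.
move=> cardA; rewrite mem_cat; apply/orP; right; apply/mapP; exists A => //.
by rewrite mem_filter cardA eqxx mem_enum.
Qed.

(** h_(k+i+1) in the variables from x_i on is the product of the generating
    series of all variables with the polynomial of the i variables before, so
    it combines the h_(k+i+1-l) of all variables with l at most i. *)
Lemma hsym_in_ideal (i : 'I_n) :
  ideal_I n k r (hsym (k + i.+1) [set j : 'I_n | (i <= j)%N]).
Proof.
pose u := vars (take i (enum 'I_n)); pose w := vars (drop i (enum 'I_n)).
have -> : hsym (k + i.+1) [set j : 'I_n | (i <= j)%N] = csym w (k + i.+1).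
  rewrite -hsym_csym ?drop_uniq ?enum_uniq //; congr hsym; apply/setP=> j; rewrite !inE.
  have : j \in take i (enum 'I_n) ++ drop i (enum 'I_n).
    by rewrite cat_take_drop mem_enum.
  rewrite mem_cat mem_take_enum => /orP[lt_j|j_drop]; last first.
    rewrite j_drop leqNgt -mem_take_enum; apply/negP=> j_take.
    have := enum_uniq 'I_n; rewrite -(cat_take_drop i (enum 'I_n)) cat_uniq.
    by case/and3P=> _ /hasPn/(_ j j_drop); rewrite j_take.
  rewrite leqNgt lt_j; apply/esym/negP=> j_drop.
  have := enum_uniq 'I_n; rewrite -(cat_take_drop i (enum 'I_n)) cat_uniq.
  by case/and3P=> _ /hasPn/(_ j j_drop); rewrite mem_take_enum lt_j.
have -> : csym w (k + i.+1) = econv u (vars (enum 'I_n)) (k + i.+1).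
  rewrite -(cat_take_drop i (enum 'I_n)) {1}/vars map_cat -/(vars _) -/(vars _).
  by rewrite -[X in econv X]cats0 econv_cancel econv_nil.
rewrite /econv; elim/big_ind: _ => [|p q|l _].
- exact: ideal_span0.
- exact: ideal_spanD.
have size_u : (size u <= i)%N by rewrite size_map size_take; case: ifP => //; lia.
have [le_l|gt_l] := leqP l i; last first.
  by rewrite epoly_gt_size ?mul0r; [apply: ideal_span0|apply: leq_ltn_trans gt_l].
apply/ideal_spanM/ideal_span_gen; left; exists (i.+1 - l)%N.
  by have := ltn_ord i; lia.
rewrite -hsym_csym ?enum_uniq //; congr (hsym _ _); first by lia.
by apply/setP=> j; rewrite !inE mem_enum.
Qed.

Lemma groebner_polysP g : g \in groebner_polys n k r ->
  (exists2 i : 'I_n, g = hsym (k + i.+1) [set j : 'I_n | (i <= j)%N] &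
     monic_at (U_(i) *+ (k + i.+1))%MM g) \/
  (exists A : {set 'I_n}, [/\ #|A| = (n - r + 1)%N,
     g = mpoly_rev (demazure (mnm_rev (skip_vector A))) &
     monic_at (skip_vector A) g]).
Proof.
rewrite mem_cat => /orP[/mapP[i _ ->]|/mapP[A]].
  by left; exists i => //; apply: monic_at_hsym.
rewrite mem_filter => /andP[/eqP cardA _] ->; right; exists A; split=> //.
exact: (monic_at_kappa cardA).
Qed.

Lemma groebner_polys_ideal g : g \in groebner_polys n k r -> ideal_I n k r g.
Proof.
case/groebner_polysP=> [[i -> _]|[A [cardA -> _]]]; first exact: hsym_in_ideal.
exact: (kappa_in_ideal cardA).
Qed.

Lemma nonstandard_lead (m : 'X_{1..n}) : ~~ standard m ->
  exists g, [/\ g \in groebner_polys n k r, monic_at (lexlead g) g &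
    (lexlead g <= m)%MM].
Proof.
case/(nonstandard_divisible le_rn) => [[i le_i]|[A cardA le_A]].
  have mon := monic_at_hsym (k + i.+1) i; have [lE _] := monic_at_lexlead mon.
  by exists (hsym (k + i.+1) [set j : 'I_n | (i <= j)%N]); rewrite groebner_hsym lE.
have mon := monic_at_kappa cardA; have [lE _] := monic_at_lexlead mon.
by eexists; split; [exact: groebner_kappa cardA| rewrite lE | rewrite lE].
Qed.

(** The deformation of a multiple of a Groebner polynomial. *)
Lemma nonstandard_vanishing (m : 'X_{1..n}) : ~~ standard m ->
  exists g, [/\ vanishing g, g@_m = 1 & forall m', (m < m')%O -> g@_m' = 0].
Proof.
move=> /nonstandard_lead[g [gG]]; set u := lexlead g => -[hg cg lg] le_um.
have [g' Vg' g'E] := ideal_deformable le_rn (groebner_polys_ideal gG) (mdeg u).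
exists ('X_[m - u] * g'); split; first exact: vanishingM.
  by rewrite mulrC mcoeffMX_le lem_subr submBA // addmC addmK g'E // eqxx.
move=> m' lt_m; rewrite mulrC mcoeffMX_le; case: ifP => // /submK m'E.
have {}lt_m : (u < (m' - (m - u))%MM)%O.
  by rewrite -(ltmc_add2l _ _ (m - u)%MM) m'E addmC submK.
rewrite g'E; last by apply: lemc_mdeg; apply: ltW.
by case: ifP => // _; apply: mcoeff_gt_mlead; rewrite lg.
Qed.

(** Division by the deformed Groebner polynomials: a leading monomial is
    either kept, when standard, or cancelled, and in both cases the rest has a
    smaller one. *)
Lemma standard_normal_form (p : {mpoly rat[n]}) : exists q,
  vanishing (p - q) /\
  forall m, m \in msupp q -> standard m /\ (m <= mlead p)%O.
Proof.
elim/mleadrect: p => p IH; have [->|p0] := eqVneq p 0.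
  by exists 0; rewrite subr0; split; [exact: vanishing0|move=> m; rewrite msupp0].
set u := mlead p in IH *.
(* [mlead 0] is 0, so q = 0 has to be kept apart from the induction. *)
have low q : (forall m, (u <= m)%O -> q@_m = 0) -> exists q',
    vanishing (q - q') /\ forall m, m \in msupp q' -> standard m /\ (m < u)%O.
  move=> q_low; have [->|q0] := eqVneq q 0.
    by exists 0; rewrite subr0; split; [exact: vanishing0|move=> m; rewrite msupp0].
  have lt_q : (mlead q < u)%O.
    rewrite ltNge; apply/negP=> /q_low E.
    by have := mlead_supp q0; rewrite mcoeff_msupp E eqxx.
  have [q' [Vq' supp_q']] := IH q lt_q; exists q'; split=> // m /supp_q'[std_m le_m].
  by split=> //; apply: le_lt_trans lt_q.
have [std_u|/nonstandard_vanishing[g [Vg g_u g_gt]]] := boolP (standard u).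
  have [|q' [Vq' supp_q']] := low (p - p@_u *: 'X_[u]).
    move=> m; rewrite le_eqVlt mcoeffB mcoeffZ mcoeffX => /orP[/eqP <-|lt_m].
      by rewrite eqxx mulr1 subrr.
    by rewrite lt_eqF // mulr0 subr0; apply: mcoeff_gt_mlead.
  exists (q' + p@_u *: 'X_[u]); split; first by rewrite opprD addrA addrAC.
  move=> m /msuppD_le; rewrite mem_cat => /orP[/supp_q'[std_m /ltW le_m]|] //.
  by move/msuppZ_le; rewrite msuppX inE => /eqP ->.
have [|q' [Vq' supp_q']] := low (p - (p@_u)%:MP * g).
  move=> m; rewrite le_eqVlt mcoeffB mcoeffCM => /orP[/eqP <-|lt_m].
    by rewrite g_u mulr1 subrr.
  by rewrite g_gt // mulr0 subr0; apply: mcoeff_gt_mlead.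
exists q'; split=> [|m /supp_q'[std_m /ltW]] //.
have -> : p - q' = p - (p@_u)%:MP * g - q' + (p@_u)%:MP * g by ring.
apply: vanishingD => //.
exact: vanishingM.
Qed.

(** Reducing all but the leading term of [p] would produce a vanishing
    combination of standard monomials that still contains that term, against
    their independence. *)
Lemma vanishing_lead_nonstandard (p : {mpoly rat[n]}) :
  vanishing p -> p != 0 -> ~~ standard (mlead p).
Proof.
move=> Vp p0; apply/negP=> std_p; set u := mlead p in std_p.
pose q := p - p@_u *: 'X_[u].
have [q' [Vq' supp_q']] := standard_normal_form q.
have low_q' : q'@_u = 0.
  apply/eqP; rewrite mcoeff_eq0; apply/negP=> uq'.
  (* If q = 0 its leading monomial is 0, which may be u. *)
  have [q0|q0] := eqVneq q 0.
    rewrite q0 sub0r in Vq'; have : q' = 0.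
      apply: (@vanishing_standard_eq0 n k r le_rn) => [|m /supp_q'[]//].
      by rewrite (_ : q' = -1 * - q'); [apply: vanishingM|ring].
    by move=> E; rewrite E msupp0 in uq'.
  have [_ le_u] := supp_q' u uq'.
  by have := ltm_mleadD p0 q0; rewrite -/u -/q ltNge le_u.
have : p@_u *: 'X_[u] + q' = 0.
  apply: (@vanishing_standard_eq0 n k r le_rn).
    have -> : p@_u *: 'X_[u] + q' = p - (q - q') by rewrite /q; ring.
    exact: vanishingB.
  move=> m /msuppD_le; rewrite mem_cat => /orP[/msuppZ_le|/supp_q'[]//].
  by rewrite msuppX inE => /eqP ->.
move/(congr1 (mcoeff u)).
rewrite mcoeffD mcoeffZ mcoeffX eqxx mulr1 low_q' addr0 mcoeff0.
by apply/eqP; rewrite mleadc_eq0.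
Qed.

(** The component of [f] in the degree of its lexicographic leading monomial
    deforms to a polynomial vanishing on the locus with the same leading
    monomial. *)
Lemma ideal_lead_divisible f : ideal_I n k r f -> f != 0 ->
  exists g, [/\ g \in groebner_polys n k r, monic_at (lexlead g) g &
    (lexlead g <= lexlead f)%MM].
Proof.
move=> If f0; apply: nonstandard_lead; set u := lexlead f.
have [lead_in lead_max] := lexleadP f0.
have [f' Vf' f'E] := ideal_deformable le_rn If (mdeg u).
have f'u : f'@_u != 0 by rewrite f'E // eqxx -mcoeff_msupp.
have <- : mlead f' = u.
  apply: mlead_eq => // m lt_m; rewrite f'E ?lemc_mdeg ?ltW //.
  case: eqP => // deg_m; apply/eqP; rewrite mcoeff_eq0; apply/negP=> fm.
  have : lexlt m u by apply: lead_max => //; rewrite gt_eqF.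
  by rewrite lexlt_ltmc // ltNge ltW.
apply: vanishing_lead_nonstandard => //.
by apply: contraNneq f'u => ->; rewrite mcoeff0.
Qed.

End NormalForm.

(** * The Groebner basis *)

Theorem corollary3p8 (n k r : nat) (le_r_n : (r <= n)%N) :
  groebner_basis (ideal_I n k r) (groebner_polys n k r) /\
  ((r < n)%N -> (0 < k)%N ->
   minimal_groebner_basis (ideal_I n k r) (groebner_polys n k r)).
Proof.
have monicG g : g \in groebner_polys n k r -> monic_at (lexlead g) g.
  case/groebner_polysP=> [[i _ mon]|[A [_ _ mon]]];
  by rewrite (monic_at_lexlead mon).1.
have gb : groebner_basis (ideal_I n k r) (groebner_polys n k r).
  split=> [g gG|p].
    by split; [exact: groebner_polys_ideal|exact: monic_at_neq0 (monicG g gG)].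
  split.
    apply: ideal_span_ind => [|? ?|q t [g gG ->]].
    - exact: ideal_span0.
    - exact: ideal_spanD.
    apply/ideal_spanM/ideal_span_gen; exists g; split=> //.
      exact: groebner_polys_ideal.
    exact: monic_at_neq0 (monicG g gG).
  apply: ideal_span_ind => [|? ?|q t [f [If f0 ->]]].
  - exact: ideal_span0.
  - exact: ideal_spanD.
  apply: ideal_spanM; have [g [gG mon le_g]] := ideal_lead_divisible le_r_n If f0.
  have -> : lexterm f = (lexleadc f *: 'X_[lexlead f - lexlead g]) * lexterm g.
    rewrite /lexterm (monic_at_lexlead mon).2 scale1r -scalerAl -mpolyXD.
    by rewrite submK.
  by apply/ideal_spanM/ideal_span_gen; exists g.
split=> // lt_rn k_gt0; split=> [//|g gG|g g' gG g'G ne [q qE]].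
  exact: (monic_at_lexlead (monicG g gG)).2.
have {q qE} le_lead : (lexlead g <= lexlead g')%MM.
  have := congr1 (mcoeff (lexlead g')) qE; rewrite /lexterm.
  rewrite !(monic_at_lexlead (monicG _ _)).2 // !scale1r mcoeffX eqxx mcoeffMX_le.
  by case: ifP => // _ /eqP; rewrite oner_eq0.
case/eqP: ne; have /mnm_lepP := le_lead.
case/groebner_polysP: gG => [[i gE mon]|[A [cardA gE mon]]];
  case/groebner_polysP: g'G => [[i' g'E mon']|[A' [cardA' g'E mon']]];
  rewrite (monic_at_lexlead mon).1 (monic_at_lexlead mon').1 => le_m.
- have := le_m i; rewrite !mulmnE !mnm1E eqxx.
  case: eqVneq => [ii' _|_]; last by lia.
  by rewrite gE g'E ii'.
- (* The exponent of the variable i in x^gamma(S) is at most i + 1. *)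
  have := le_m i; rewrite mulmnE mnm1E eqxx mul1n mnmE.
  case: ifP => [iA'|_]; last by lia.
  have : (0 < #|[set s in A' | (s <= i)%N]|)%N.
    by apply/card_gt0P; exists i; rewrite inE iA' leqnn.
  by lia.
- (* For r < n the monomial x^gamma(S) involves at least two variables. *)
  have [j jA ne_j] : exists2 j, j \in A & j != i'.
    have : (0 < #|A :\ i'|)%N 
      by rewrite -(ltn_add2l (i' \in A)) -cardsD1 cardA addn0; case: (_ \in _); lia.
    by case/card_gt0P=> j; rewrite !inE => /andP[ne jA]; exists j.
  have := le_m j; rewrite mulmnE mnm1E mnmE jA eq_sym (negPf ne_j) addn1.
  by rewrite mul0n.
- (* The variables of x^gamma(S) are those in S. *)
  suff E : A = A' by rewrite gE g'E E.
  apply/eqP; rewrite eqEcard cardA cardA' leqnn andbT; apply/subsetP=> j jA.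
  by have := le_m j; rewrite !mnmE jA; case: ifP => // _; rewrite addn1.
Qed.
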